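(* For first-passage percolation on the ladder $\mathcal{G}^{\{\mathcal{X},\mathcal{Y},\mathcal{Z}\}}$ with independent standard exponential edge weights, almost surely $$\chi=\lim_{n\to\infty}\frac{l_n}{n}=\frac32-\frac{\mathrm{J}_1(2)}{2\,\mathrm{J}_2(2)}\approx 0.68,$$ where $\mathrm{J}_\nu$ is the Bessel function of the first kind of order $\nu$.
   Context: Ladder model $\mathcal{G}^{\{\mathcal{X},\mathcal{Y},\mathcal{Z}\}}$: for $n\ge0$, $G_n$ has vertex set $\{0,\dots,n\}\times\{0,1\}$ and edges: for $1\le i\le n$, an edge joining $(i-1,0)$ and $(i,0)$, an edge joining $(i-1,1)$ and $(i,1)$; for $0\le i\le n$, an edge joining $(i,0)$ and $(i,1)$. All edge weights are independent standard exponential random variables (density $e^{-x}$, $x>0$). Path weight = sum of edge weights; $l_n$ is the minimal weight of a path in $G_n$ from $(0,0)$ to $(n,0)$. *)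

(* Defs.v *)
From HB Require Import structures.
From mathcomp Require Import all_boot all_order all_algebra.
From mathcomp Require Import all_classical all_reals all_analysis.
Set Implicit Arguments. Unset Strict Implicit. Unset Printing Implicit Defensive.
Import Order.TTheory GRing.Theory Num.Theory.
Import numFieldNormedType.Exports.
Local Open Scope classical_set_scope.
Local Open Scope ring_scope.

Definition besselJ {R : realType} (nu : nat) (x : R) : R :=
  limn (series (fun k : nat =>
    (-1) ^+ k / ((k`!)%:R * ((k + nu)`!)%:R) * (x / 2) ^+ (2 * k + nu))).

(** Vertices of the ladder: (i, b) = column i, row b (false = row 0, true = row 1). *)
Definition lvertex := (nat * bool)%type.

(** Edges of the infinite ladder:
    inl (b, i) = horizontal edge in row b joining (i, b) and (i+1, b);
    inr i      = vertical rung joining (i, 0) and (i, 1). *)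
Definition ledge := ((bool * nat) + nat)%type.

Definition ladj (n : nat) : rel lvertex := fun u v =>
  [&& (u.1 <= n)%N, (v.1 <= n)%N &
   ((u.2 == v.2) && ((u.1.+1 == v.1) || (v.1.+1 == u.1)))
   || ((u.1 == v.1) && (u.2 != v.2))].

Definition ledge_of (u v : lvertex) : ledge :=
  if u.2 == v.2 then inl (u.2, minn u.1 v.1) else inr u.1.

Definition ladder_path (n : nat) (s t : lvertex) (p : seq lvertex) : bool :=
  [&& path (ladj n) s p, last s p == t & uniq (s :: p)].

Definition path_weight {R : realType} (w : ledge -> R) (s : lvertex)
    (p : seq lvertex) : R :=
  \sum_(e <- pairmap ledge_of s p) w e.

Definition ladder_passage {R : realType} (w : ledge -> R) (n : nat) : R :=
  inf [set path_weight w (0%N, false) p |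
        p in [set p | ladder_path n (0%N, false) (n, false) p]].

Definition mutually_independent {d} {T : measurableType d} {R : realType}
    (P : probability T R) {I : eqType} (X : I -> T -> R) : Prop :=
  forall (J : seq I) (B : I -> set R),
    uniq J -> (forall i, measurable (B i)) ->
    P (\bigcap_(i in [set` J]) (X i @^-1` B i)) =
    (\prod_(i <- J) P (X i @^-1` B i))%E.

(* Main.v *)
Require Import Defs.
From HB Require Import structures.
From mathcomp Require Import all_boot all_order all_algebra.
From mathcomp Require Import all_classical all_reals all_analysis.
From mathcomp Require Import measurable_realfun ring lra.
Import Order.TTheory GRing.Theory Num.Theory.
Import numFieldNormedType.Exports.
Local Open Scope classical_set_scope.
Local Open Scope ring_scope.

(** Let a_n and b_n be the distances from (0,0) to (n,0) and (n,1) in G_n and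
    D_n = b_n - a_n.  Simple paths never go back, so that
    min(a_(n+1), b_(n+1)) = min(a_n + X, b_n + Y) and D_(n+1) is D_n + Y - X
    clamped to [-Z, Z].  The constant chi is found by solving Poisson's equation
    for the Markov chain D: a bounded H such that min(a_n, b_n) + H(|D_n|) - n chi
    is a martingale.  On the half-line, m = H' satisfies
    m'' = (1 - e^(-x)) m with m(0) = 1/2, whose bounded solution is
    J_2(2 e^(-x/2)) / (2 J_2(2)) = (2 J_2(2))^-1 * sum_k alpha_k e^(-(k+1)x) with
    alpha_k = (-1)^k / (k! (k+2)!).  Truncating this series after K terms gives a
    finite combination of exponentials that solves Poisson's equation for a
    constant chi_K up to an error eps_K, where chi_K -> chi and eps_K -> 0.  The
    compensated martingale has increments bounded in L^2, so its second moment
    grows linearly and it is o(n) almost surely along the squares; monotonicity of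
    min(a_n, b_n) and the bound |D_n| <= Z_n = o(n) conclude. *)

(** * Means under the exponential law *)

Definition exponential_law {R : realType} (mu : set R -> \bar R) :=
  forall B : set R, measurable B -> mu B = exponential_prob 1 B.

Import HBNNSimple.
(** [mu] is known only through its values on measurable sets; decomposing [f] into indicators of its
    level sets reduces the formula to the definition of the exponential law. *)
Lemma integral_exponential_law_nnsfun (R : realType) (mu : {measure set R -> \bar R})
    (f : {nnsfun R >-> R}) : exponential_law mu ->
  (\int[mu]_x (f x)%:E =
   \int[lebesgue_measure]_x ((f x)%:E * (exponential_pdf 1 x)%:E))%E.
Proof.
move=> muE.
have pdf0 (x : R) : 0 <= exponential_pdf (1 : R) x by exact: exponential_pdf_ge0.
have mpdf : measurable_fun (setT : set R) (fun x : R => ((exponential_pdf (1 : R) x : R)%:E : \bar R)).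
  by apply/measurable_EFinP; exact: measurable_exponential_pdf.
have mind (r : R) : measurable_fun (setT : set R)
    (fun x : R => ((r * \1_(f @^-1` [set r]) x)%:E : \bar R)).
  by apply/measurable_EFinP/measurableT_comp.
have mind1 (r : R) : measurable_fun (setT : set R)
    (fun x : R => ((\1_(f @^-1` [set r]) x)%:E : \bar R)).
  by apply/measurable_EFinP.
under [LHS]eq_integral do rewrite fimfunE -fsumEFin//.
rewrite [LHS]ge0_integral_fsum//; last first.
  by move=> n x _; rewrite EFinM nnfun_muleindic_ge0.
under [RHS]eq_integral.
  move=> x xD; rewrite fimfunE -fsumEFin// muleC ge0_mule_fsumr; last first.
    by move=> r; rewrite EFinM nnfun_muleindic_ge0.
  over.
rewrite [RHS]ge0_integral_fsum//; last 2 first.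
  - by move=> r; exact: (emeasurable_funM mpdf (mind r)).
  - move=> n x _; rewrite mule_ge0 ?lee_fin//.
    by rewrite -lee_fin EFinM nnfun_muleindic_ge0.
apply: eq_fsbigr => r _.
rewrite integralZl_indic_nnsfun//= integral_indic// setIT.
under [RHS]eq_integral do rewrite EFinM muleCA.
(* A value [r] that is not attained may be negative, so an empty level set is treated apart. *)
have [->|fr0] := eqVneq (f @^-1` [set r]) set0.
  rewrite measure0 mule0; under eq_integral do rewrite indic0 mule0 mule0.
  by rewrite integral0.
have r0 : 0 <= r.
  by move/set0P: fr0 => [x <-].
rewrite ge0_integralZl//; last first.
- by move=> x _; rewrite mule_ge0 ?lee_fin.
- exact: (emeasurable_funM mpdf (mind1 r)).
congr (_ * _)%E; rewrite muE// /exponential_prob [LHS]integral_mkcond.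
by apply: eq_integral => x _; rewrite patchE indicE; case: ifPn => _; rewrite ?mule1 ?mule0.
Qed.

Lemma ge0_integral_exponential_law (R : realType) (mu : {measure set R -> \bar R})
    (f : R -> \bar R) : exponential_law mu ->
  measurable_fun setT f -> (forall x, 0 <= f x)%E ->
  (\int[mu]_x f x =
   \int[lebesgue_measure]_(x in `[0%R, +oo[) (f x * (expR (- x))%:E))%E.
Proof.
move=> muE mf f0.
have pdf0 (x : R) : 0 <= exponential_pdf (1 : R) x by exact: exponential_pdf_ge0.
have mpdf : measurable_fun (setT : set R) (fun x : R => ((exponential_pdf (1 : R) x : R)%:E : \bar R)).
  by apply/measurable_EFinP; exact: measurable_exponential_pdf.
transitivity (\int[lebesgue_measure]_x (f x * (exponential_pdf 1 x)%:E))%E; last first.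
  rewrite [RHS]integral_mkcond; apply: eq_integral => x _.
  rewrite patchE /exponential_pdf patchE; case: ifPn => _; last by rewrite mule0.
  by rewrite mul1r mulN1r.
pose f_ := nnsfun_approx measurableT mf.
transitivity (lim (\int[mu]_x (f_ n x)%:E @[n --> \oo])%E).
  rewrite -monotone_convergence//=.
  - apply: eq_integral => ? /[!inE] xD; apply/esym/cvg_lim => //=.
    exact: cvg_nnsfun_approx.
  - by move=> n; exact/measurable_EFinP/measurable_funTS.
  - by move=> n ? _; rewrite lee_fin.
  - by move=> ? _ ? ? mn; rewrite lee_fin; exact/lefP/nd_nnsfun_approx.
under eq_fun do rewrite integral_exponential_law_nnsfun//.
rewrite -monotone_convergence//=.
- apply: eq_integral => x _; apply/cvg_lim => //.
  apply: cvgeZr => //; exact: cvg_nnsfun_approx.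
- move=> n; have mfn : measurable_fun (setT : set R) (fun x : R => ((f_ n x)%:E : \bar R)).
    exact/measurable_EFinP/measurable_funTS.
  exact: (emeasurable_funM mfn mpdf).
- by move=> n x _; rewrite mule_ge0 ?lee_fin.
- move=> x _ m n mn; rewrite lee_wpmul2r ?lee_fin//.
  by have /lefP := nd_nnsfun_approx measurableT mf mn; apply.
Qed.

(** This is the boundary term at infinity for the antiderivative [- G x e^(-x)]. Quadratic growth is
    allowed because second moments are integrated as well. *)
Lemma cvg_mul_expRN (R : realType) (K : R) (G : R -> R) :
  (forall x, 0 <= x -> `|G x| <= K * (1 + x) ^+ 2) ->
  G x * expR (- x) @[x --> +oo] --> 0.
Proof.
move=> GK.
(* Half of the exponential decay is spent on the quadratic factor; 16 is the square of the 4 in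
   [1 + x <= 4 * expR (x / 4)]. *)
have h (x : R) : 0 <= x -> (1 + x) ^+ 2 * expR (- x) <= 16 * expR (- (x / 2)).
  move=> x0; have x1 : 1 + x <= 4 * expR (x / 4).
    by have := @expR_ge1Dx R (x / 4); lra.
  have -> : expR (- (x / 2)) = expR (x / 4) ^+ 2 * expR (- x).
    by rewrite -expRM_natl -expRD; congr expR; field.
  rewrite mulrA ler_pM2r ?expR_gt0//.
  have -> : 16 * expR (x / 4) ^+ 2 = (4 * expR (x / 4)) ^+ 2 by ring.
  by rewrite lerXn2r// nnegrE; [lra|rewrite mulr_ge0 ?expR_ge0].
have K0 : 0 <= K by have := GK 0 (lexx 0); rewrite addr0 expr1n mulr1; exact: le_trans.
have hlim : K * (16 * expR (- (x / 2))) @[x --> +oo] --> (0 : R).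
  rewrite -(mulr0 K) -[in X in _ * X](mulr0 16); do 2 apply: cvgMr.
  have h2 : (x / 2 : R) @[x --> +oo] --> +oo.
    apply/cvgryPge => A; near=> x.
    by rewrite ler_pdivlMr//; near: x; exact: nbhs_pinfty_ge.
  exact: (cvg_comp _ _ h2 (@cvgr_expR R)).
apply: (@squeeze_cvgr _ _ _ _ (fun x => - (K * (16 * expR (- (x / 2))))) (fun x => K * (16 * expR (- (x / 2))))) => //.
  near=> x; have x0 : 0 <= x by near: x; exact: nbhs_pinfty_ge.
  rewrite -ler_norml normrM (ger0_norm (expR_ge0 _)).
  apply: (@le_trans _ _ (K * ((1 + x) ^+ 2 * expR (- x)))); last by rewrite ler_wpM2l// h.
  by rewrite mulrA ler_pM2r ?expR_gt0// GK.
by rewrite -[X in _ --> X]oppr0; exact: cvgN.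
Unshelve. all: by end_near. Qed.

(* [G x] is the mean of [f (x + X)] for [X] exponential: [- G x e^(-x)] is an
   antiderivative of [f x e^(-x)].  The absolute value makes the values of [f] on the
   negative half-line, a null set, irrelevant. *)
Lemma integral_exponential_law_cert (R : realType) (mu : {measure set R -> \bar R})
    (f G : R -> R) (K : R) : exponential_law mu ->
  (forall x, 0 <= x -> 0 <= f x) -> continuous f ->
  (forall x : R, is_derive x 1 G (G x - f x)) ->
  (forall x, 0 <= x -> `|G x| <= K * (1 + x) ^+ 2) ->
  (\int[mu]_x (f `|x|)%:E = (G 0)%:E)%E.
Proof.
move=> muE f0 cf dG /cvg_mul_expRN Goo.
rewrite (ge0_integral_exponential_law _ _ _ muE); last 2 first.
- apply/measurable_EFinP; apply: measurableT_comp => //.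
  exact: continuous_measurable_fun.
- by move=> x; rewrite lee_fin f0.
pose p x := f x * expR (- x).
have cE : continuous (fun x : R => expR (- x)).
  by move=> x; apply: continuous_comp; [exact: opp_continuous|exact: continuous_expR].
transitivity (\int[lebesgue_measure]_(x in `[0%R, +oo[) (p x)%:E)%E.
  apply: eq_integral => x; rewrite inE/= in_itv/= andbT => x0.
  by rewrite ger0_norm.
have dF (x : R) : is_derive x 1 (fun x => - (G x * expR (- x))) (p x).
  have := dG x => dGx.
  apply: is_derive_eq.
  rewrite /p /GRing.scale /=; ring.
rewrite (@ge0_continuous_FTC2y _ p (fun x => - (G x * expR (- x))) 0 0).
- by rewrite oppr0 expR0 mulr1 -EFinB sub0r opprK.
- by move=> x x0; rewrite mulr_ge0 ?f0 ?expR_ge0.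
- by apply: continuous_subspaceT => x; exact: cvgM (cf x) (cE x).
- by rewrite -[X in _ --> X]oppr0; exact: cvgN.
- by move=> x _; have [] := dF x.
- have /derivable1_diffP/differentiable_continuous dF0 := @ex_derive _ _ _ _ _ _ _ (dF 0).
  exact: cvg_at_right_filter dF0.
- by move=> x _; rewrite derive1E; apply: derive_val.
Qed.

(* Since [f] has mean [G 0 = 0], the cross term [2 m f] does not contribute; keeping it
   inside the nonnegative function [m^2 + 2 m f + (x + C)^2] spares integrability. *)
Lemma exponential_law_sqr_le (R : realType) (mu : {measure set R -> \bar R})
    (f G : R -> R) (m C K : R) : exponential_law mu -> 0 <= C ->
  continuous f -> (forall x, 0 <= x -> `|f x| <= x + C) ->
  (forall x : R, is_derive x 1 G (G x - f x)) ->
  (forall x, 0 <= x -> `|G x| <= K * (1 + x) ^+ 2) -> G 0 = 0 ->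
  (\int[mu]_x ((m + f `|x|) ^+ 2)%:E <= (m ^+ 2 + (C ^+ 2 + 2 * C + 2))%:E)%E.
Proof.
move=> muE C0 cf fC dG Goo G0.
pose h x := m ^+ 2 + 2 * m * f x + (x + C) * (x + C).
(* [Q] is the certificate of [h]: [G] certifies [f], and [u ^ 2 + 2 u + 2] certifies [u ^ 2] for
   [u = x + C]. *)
pose Q x := m ^+ 2 + 2 * m * G x + ((x + C) ^+ 2 + 2 * (x + C) + 2).
have -> : m ^+ 2 + (C ^+ 2 + 2 * C + 2) = Q 0 by rewrite /Q G0; ring.
have h0 x : 0 <= x -> (m + f x) ^+ 2 <= h x.
  move=> x0; rewrite /h sqrrD -mulr_natl mulrA lerD2l -expr2.
  by have := fC x x0; rewrite ler_norml => /andP[]; nra.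
have ch : continuous h.
  move=> x; apply: cvgD; last by apply: cvgM; apply: cvgD; [exact: cvg_id|exact: cvg_cst|exact: cvg_id|exact: cvg_cst].
  by apply: cvgD; [exact: cvg_cst|apply: cvgM; [exact: cvg_cst|exact: cf]].
apply: (@le_trans _ _ (\int[mu]_x (h `|x|)%:E)%E).
  apply: ge0_le_integral => //.
  - by move=> x _; rewrite lee_fin sqr_ge0.
  - apply/measurable_EFinP/measurable_funX/measurable_funD => //.
    by apply: measurableT_comp => //; exact: continuous_measurable_fun.
  - by apply/measurable_EFinP; apply: measurableT_comp => //; exact: continuous_measurable_fun.
  - by move=> x _; rewrite lee_fin h0.
suff -> : (\int[mu]_x (h `|x|)%:E = (Q 0)%:E)%E by [].
apply: (integral_exponential_law_cert _ _ _ _ (m ^+ 2 + 2 * `|m| * K + (C ^+ 2 + 2 * C + 2)) muE) => //.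
- by move=> x x0; rewrite (le_trans _ (h0 _ x0)) ?sqr_ge0.
- move=> x; have := dG x => dGx; apply: is_derive_eq.
  rewrite /Q /h /GRing.scale /=; ring.
- move=> x x0; rewrite /Q [in leRHS]mulrDl; apply: (le_trans (ler_normD _ _)); apply: lerD.
    rewrite [in leRHS]mulrDl; apply: (le_trans (ler_normD _ _)); apply: lerD.
      by rewrite ger0_norm ?sqr_ge0// ler_peMr ?sqr_ge0//; nra.
    by rewrite !normrM ger0_norm// -[leRHS]mulrA ler_wpM2l ?mulr_ge0//; exact: Goo.
  rewrite ger0_norm; last by nra.
  suff : 0 <= (C ^+ 2 + 2 * C + 1) * x ^+ 2 + (2 * C ^+ 2 + 2 * C + 2) * x by nra.
  by rewrite addr_ge0// mulr_ge0// ?sqr_ge0//; nra.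
Qed.

(** * Independence *)

(* [V] is independent of the family [(X i)_(i in F)], which is itself independent. *)
Definition fresh {d d'} {T : measurableType d} {S : measurableType d'}
    {R : realType} {P : probability T R} {I : eqType} (X : I -> {RV P >-> R})
    (F : pred I) (V : T -> S) : Prop :=
  forall (A : set S) (J : seq I) (B : I -> set R),
    measurable A -> uniq J -> all F J -> (forall i, measurable (B i)) ->
    P (V @^-1` A `&` \bigcap_(i in [set` J]) (X i @^-1` B i)) =
    (P (V @^-1` A) * \prod_(i <- J) P (X i @^-1` B i))%E.

Lemma fresh_sub {d d'} {T : measurableType d} {S : measurableType d'}
    {R : realType} {P : probability T R} {I : eqType} (X : I -> {RV P >-> R})
    (F F' : pred I) (V : T -> S) :
  subpred F' F -> fresh X F V -> fresh X F' V.
Proof.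
by move=> sF XF A J B mA uJ /(sub_all sF) aJ mB; exact: XF.
Qed.

Lemma fresh_comp {d d1 d2} {T : measurableType d} {S1 : measurableType d1}
    {S2 : measurableType d2} {R : realType} {P : probability T R} {I : eqType}
    (X : I -> {RV P >-> R}) (F : pred I) (V : T -> S1) (k : S1 -> S2) :
  measurable_fun setT k -> fresh X F V -> fresh X F (k \o V).
Proof.
move=> mk XF A J B mA uJ aJ mB; apply: (XF (k @^-1` A)) => //.
by rewrite -[X in measurable X]setTI; exact: mk.
Qed.

(** For fixed [J] and [B], both sides are measures in [C]. Freshness equates them on rectangles,
    hence everywhere by uniqueness of the product measure; the factor [p] is absorbed into the
    second marginal. *)
Lemma fresh_pair_setI {d d'} {T : measurableType d} {S : measurableType d'}
    {R : realType} {P : probability T R} {I : eqType} (X : I -> {RV P >-> R})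
    (F : pred I) (V : {RV P >-> S}) (e : I) : fresh X F V -> F e ->
  forall (C : set (S * R)) (J : seq I) (B : I -> set R),
    measurable C -> uniq J -> all (predD1 F e) J -> (forall i, measurable (B i)) ->
  P ((fun x => (V x, X e x)) @^-1` C `&` \bigcap_(i in [set` J]) (X i @^-1` B i)) =
  ((distribution P V \x distribution P (X e)) C *
   \prod_(i <- J) P (X i @^-1` B i))%E.
Proof.
move=> XF Fe C J B mC uJ aJ mB.
set G := \bigcap_(i in _) _.
set p := (\prod_(i <- J) _)%E.
have mXB i : measurable (X i @^-1` B i).
  by rewrite -[Y in measurable Y]setTI; exact: measurable_funP.
have mG : measurable G by apply: fin_bigcap_measurable => //; exact: finite_seq.
have p0 : (0 <= p)%E by apply: prode_ge0 => i _.
have pfin : p \is a fin_num.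
  rewrite /p; by apply: prode_fin_num => i _; rewrite fin_num_measure.
have [r pE] : exists r : {nonneg R}, p = r%:num%:E.
  exists (NngNum (fine_ge0 p0)); by rewrite /= fineK.
have mVX : measurable_fun setT (fun x => (V x, X e x)).
  by apply: measurable_fun_pair; exact: measurable_funP.
pose pf : {measure set (S * R) -> \bar R} :=
  pushforward (mrestr P mG) (fun x => (V x, X e x)).
pose m' := pf mVX.
have m'E A D : measurable A -> measurable D ->
    m' (A `*` D) = (distribution P V A * mscale r (distribution P (X e)) D)%E.
  move=> mA mD; rewrite /m' /pf /pushforward /mrestr /= /mscale /= -pE.
  pose B' i := if i == e then D else B i.
  have eJ : e \notin J.
    by apply/negP => /(allP aJ) /=; rewrite eqxx.
  have BB' i : i \in J -> B' i = B i.
    by move=> iJ; rewrite /B' ifN//; apply: contraNneq eJ => <-.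
  have := XF A (e :: J) B' mA.
  rewrite /= eJ uJ Fe => /(_ erefl); rewrite (sub_all _ aJ); last by move=> i /andP[].
  have mB' i : measurable (B' i) by rewrite /B'; case: ifP.
  move=> /(_ erefl mB'); rewrite big_cons.
  have -> : (\prod_(i <- J) P (X i @^-1` B' i) = p)%E.
    by rewrite /p !big_seq; apply: eq_bigr => i iJ; rewrite BB'.
  have B'e : B' e = D by rewrite /B' eqxx.
  rewrite B'e => VE; rewrite /distribution /pushforward (muleC p) -VE.
  rewrite /mrestr; congr (P _); apply/seteqP; split => x /=.
    move=> [[Ax Dx] Gx]; split => // i; rewrite /= inE => /predU1P[->|iJ].
      by rewrite B'e.
    by rewrite BB'//; exact: Gx.
  move=> [Ax Gx]; split; first by split => //; rewrite -B'e; apply: Gx; rewrite /= mem_head.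
  by move=> i /= iJ; rewrite -BB'//; apply: Gx; rewrite /= inE iJ orbT.
have := product_measure_unique m'E mC.
rewrite -[RHS]/(P ((fun x => (V x, X e x)) @^-1` C `&` G)) => <-.
rewrite /product_measure1/= muleC pE -ge0_integralZl//.
exact: measurable_fun_xsection.
Qed.

Lemma fresh_pair {d d'} {T : measurableType d} {S : measurableType d'}
    {R : realType} {P : probability T R} {I : eqType} (X : I -> {RV P >-> R})
    (F : pred I) (V : {RV P >-> S}) (e : I) : fresh X F V -> F e ->
  fresh X (predD1 F e) (fun x => (V x, X e x)).
Proof.
move=> XF Fe C J B mC uJ aJ mB; rewrite (fresh_pair_setI _ _ _ _ XF)//; congr (_ * _)%E.
have := fresh_pair_setI _ _ _ _ XF Fe C [::] (fun=> setT) mC isT isT (fun=> measurableT).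
by rewrite big_nil mule1 set_nil bigcap_set0 setIT.
Qed.

(** The joint law of [V] and [X e] is the product of their laws, so Tonelli applies. *)
Lemma fresh_expectation {d d'} {T : measurableType d} {S : measurableType d'}
    {R : realType} {P : probability T R} {I : eqType} (X : I -> {RV P >-> R})
    (F : pred I) (V : {RV P >-> S}) (e : I) (h : S * R -> \bar R) :
  fresh X F V -> F e -> measurable_fun setT h -> (forall z, 0 <= h z)%E ->
  (\int[P]_x h (V x, X e x) =
   \int[P]_x \int[distribution P (X e)]_y h (V x, y))%E.
Proof.
move=> XF Fe mh h0.
have mVX : measurable_fun setT (fun x => (V x, X e x)).
  by apply: measurable_fun_pair; exact: measurable_funP.
transitivity (\int[pushforward P (fun x => (V x, X e x))]_z h z)%E.
  by rewrite (ge0_integral_pushforward mVX).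
rewrite (eq_measure_integral (distribution P V \x distribution P (X e))%E); last first.
  move=> C mC _.
  have := fresh_pair_setI _ _ _ _ XF Fe C [::] (fun=> setT) mC isT isT (fun=> measurableT).
  by rewrite big_nil mule1 set_nil bigcap_set0 setIT.
rewrite fubini_tonelli1// ge0_integral_distribution//.
- exact: measurable_fun_fubini_tonelli_F.
- by move=> y; exact: integral_ge0.
Qed.

(** Conditionally on [V], the increment [f] has mean [G v 0 = 0], so the square grows only by the
    bound of [exponential_law_sqr_le]. *)
Lemma fresh_sqr_step {d d'} {T : measurableType d} {S : measurableType d'}
    {R : realType} {P : probability T R} {I : eqType} (X : I -> {RV P >-> R})
    (F : pred I) (V : {RV P >-> S}) (e : I) (m : S -> R) (f G : S -> R -> R)
    (C : R) :
  fresh X F V -> F e -> exponential_law (distribution P (X e)) -> 0 <= C ->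
  measurable_fun setT m -> measurable_fun setT (fun z : S * R => f z.1 z.2) ->
  (forall v, continuous (f v)) ->
  (forall v x, 0 <= x -> `|f v x| <= x + C) ->
  (forall v (x : R), is_derive x 1 (G v) (G v x - f v x)) ->
  (forall v, exists K, forall x, 0 <= x -> `|G v x| <= K * (1 + x) ^+ 2) ->
  (forall v, G v 0 = 0) ->
  (\int[P]_x ((m (V x) + f (V x) `|X e x|) ^+ 2)%:E <=
   \int[P]_x ((m (V x)) ^+ 2)%:E + (C ^+ 2 + 2 * C + 2)%:E)%E.
Proof.
move=> XF Fe Xe C0 mm mf cf fC dG GK G0.
pose h (z : S * R) : \bar R := ((m z.1 + f z.1 `|z.2|) ^+ 2)%:E.
have mh : measurable_fun setT h.
  apply/measurable_EFinP; apply: measurable_funX; apply: measurable_funD.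
    exact: measurableT_comp.
  have -> : (fun x : S * R => f x.1 `|x.2|) =
      (fun z : S * R => f z.1 z.2) \o (fun z => (z.1, `|z.2|)) by [].
  apply: measurableT_comp => //; apply: measurable_fun_pair => //.
  exact: measurableT_comp.
rewrite (fresh_expectation _ _ _ _ h XF Fe mh); last by move=> z; rewrite lee_fin sqr_ge0.
have mmV : measurable_fun setT (fun x => ((m (V x)) ^+ 2)%:E).
  by apply/measurable_EFinP; apply: measurable_funX; exact: measurableT_comp.
have K0 : 0 <= C ^+ 2 + 2 * C + 2 by nra.
apply: (@le_trans _ _ (\int[P]_x (((m (V x)) ^+ 2)%:E + (C ^+ 2 + 2 * C + 2)%:E))%E).
  apply: ge0_le_integral => //.
  - move=> x _; apply: integral_ge0 => y _; by rewrite lee_fin sqr_ge0.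
  - have h0 z : (0 <= h z)%E by rewrite lee_fin sqr_ge0.
    have mF := @measurable_fun_fubini_tonelli_F _ _ _ _ _ (distribution P (X e)) h mh h0.
    rewrite (_ : (fun x => _) = fubini_F (distribution P (X e)) h \o V)//.
    by apply: measurableT_comp => //; exact: measurable_funP.
  - exact: emeasurable_funD.
  - move=> x _; have [K GvK] := GK (V x); have dGx := dG (V x).
    rewrite -EFinD; have := @exponential_law_sqr_le _ (distribution P (X e)) (f (V x)) (G (V x)) (m (V x)) C K Xe C0 (cf _) (fC _) dGx GvK (G0 _).
    exact.
rewrite ge0_integralD//.
  have := @integral_cst _ _ _ P setT measurableT (C ^+ 2 + 2 * C + 2)%:E; rewrite /cst => ->.
  by have := @probability_setT _ _ _ P => /= ->; rewrite mule1.
by move=> x _; rewrite lee_fin sqr_ge0.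
Qed.

(** * Almost sure convergence from second moments, along the squares *)

Lemma sum_inv_sqr_le (R : realType) (n : nat) :
  \sum_(0 <= k < n) (k.+1%:R ^+ 2)^-1 <= 2 - 2 / n.+1%:R :> R.
Proof.
elim: n => [|n IH]; first by rewrite big_nil divr1 subrr.
rewrite big_nat_recr//=; apply: le_trans (lerD IH (lexx _)) _.
have n1 : (0 : R) < n.+1%:R by rewrite ltr0n.
have -> : n.+2%:R = n.+1%:R + 1 :> R by rewrite -natr1.
have n1' : (1 : R) <= n.+1%:R by rewrite ler1n.
move: (n.+1%:R : R) n1 n1' => y y0 y1.
rewrite -subr_ge0.
(* The bound grows by [2 / (y (y + 1))], which is at least [1 / y ^ 2] because [y >= 1]. *)
have -> : 2 - 2 / (y + 1) - (2 - 2 / y + (y ^+ 2)^-1) = (y - 1) / (y ^+ 2 * (y + 1)).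
  by field; rewrite !gt_eqF// ltr_wpDr.
by rewrite divr_ge0 ?mulr_ge0 ?sqr_ge0//; lra.
Qed.

(** The sum of the squares has mean at most [2 c], so it is almost surely finite and its terms tend
    to 0. *)
Lemma ae_cvg0_sqr {d} {T : measurableType d} {R : realType}
    (P : {measure set T -> \bar R}) (f : nat -> T -> R) (c : R) :
  (forall n, measurable_fun setT (f n)) ->
  (forall n, \int[P]_x ((f n x) ^+ 2)%:E <= (c / n.+1%:R ^+ 2)%:E)%E ->
  {ae P, forall x, f ^~ x @ \oo --> (0 : R)}.
Proof.
move=> mf fc.
have msq n : measurable_fun setT (fun x => ((f n x) ^+ 2)%:E).
  by apply/measurable_EFinP; exact: measurable_funX.
have sq0 n x : (0 <= ((f n x) ^+ 2)%:E)%E by rewrite lee_fin sqr_ge0.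
have c0 : 0 <= c.
  have := fc 0%N; rewrite expr1n divr1 -lee_fin; apply: le_trans.
  by apply: integral_ge0 => x _.
have S0 x : (0 <= \sum_(n <oo) ((f n x) ^+ 2)%:E)%E by apply: nneseries_ge0.
have mS : measurable_fun setT (fun x => \sum_(n <oo) ((f n x) ^+ 2)%:E)%E.
  by apply: ge0_emeasurable_sum.
have intS : P.-integrable setT (fun x => \sum_(n <oo) ((f n x) ^+ 2)%:E)%E.
  apply/integrableP; split => //.
  under eq_integral do rewrite gee0_abs//.
  rewrite integral_nneseries//.
  apply: (@le_lt_trans _ _ (c * 2)%:E); last exact: ltry.
  apply: lime_le; first by apply: is_cvg_nneseries => n _ _; exact: integral_ge0.
  apply: nearW => n.
  apply: (@le_trans _ _ (\sum_(0 <= k < n) (c / k.+1%:R ^+ 2)%:E)%E).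
    exact: lee_sum.
  rewrite sumEFin lee_fin -mulr_sumr ler_wpM2l//.
  apply: (le_trans (sum_inv_sqr_le _ _)).
  by rewrite lerBlDr lerDl divr_ge0.
have := integrable_ae measurableT intS.
apply: filterS => x /(_ I); rewrite ge0_fin_numE// => Sfin.
have cs : cvgn (series (fun n => (f n x) ^+ 2)).
  apply: nondecreasing_is_cvgn.
    by apply/nondecreasing_seqP => n; rewrite seriesEnat/= big_nat_recr//= lerDl sqr_ge0.
  exists (fine (\sum_(n <oo) ((f n x) ^+ 2)%:E)%E) => _ [n _ <-].
  rewrite -lee_fin fineK; last by rewrite ge0_fin_numE.
  rewrite seriesEnat /= -sumEFin; exact: nneseries_lim_ge.
have /cvgrPdist_lt h := cvg_series_cvg_0 cs.
apply/cvgrPdist_lt => e e0.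
have e20 : 0 < e ^+ 2 by rewrite exprn_gt0.
move: (h _ e20); apply: filterS => n.
rewrite !sub0r !normrN ger0_norm ?sqr_ge0// => fe.
by rewrite -(ltr_pXn2r (_ : 0 < 2)%N) ?nnegrE// ?ltW// real_normK// num_real.
Qed.

Lemma exists_isqrt (n : nat) : exists k, (k ^ 2 <= n < k.+1 ^ 2)%N.
Proof.
elim: n => [|n [k /andP[kn nk]]]; first by exists 0%N.
have [h|h] := ltnP n.+1 (k.+1 ^ 2)%N; first by exists k; rewrite h (leq_trans kn).
by exists k.+1; rewrite h (leq_ltn_trans nk)// ltn_exp2r.
Qed.

(** If [k ^ 2 <= n < (k + 1) ^ 2], monotonicity puts [u n / n] between [u (k ^ 2) / (k + 1) ^ 2] and
    [u ((k + 1) ^ 2) / k ^ 2]. *)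
Lemma cvg_div_of_squares (R : realType) (u : nat -> R) (l : R) :
  (forall n, 0 <= u n) -> {homo u : m n / (m <= n)%N >-> m <= n} ->
  (fun n => u (n.+1 ^ 2)%N / (n.+1 ^ 2)%:R) @ \oo --> l ->
  (fun n => u n / n%:R) @ \oo --> l.
Proof.
move=> u0 uh ul.
have [K Kn] := choice exists_isqrt.
have Koo : K @ \oo --> \oo.
  apply/cvgnyPge => m; near=> n.
  have /andP[_ nK] := Kn n.
  rewrite -ltnS -(ltn_exp2r _ _ (_ : 0 < 2)%N)//; apply: leq_ltn_trans nK.
  by near: n; exact: nbhs_infty_ge.
pose A k := u (k ^ 2)%N / (k ^ 2)%:R.
have Al : A @ \oo --> l by rewrite -(cvg_shiftS A).
have A1l : (fun k => A k.+1) @ \oo --> l by rewrite cvg_shiftS.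
(* Squares of [q k], which tend to 1, exchange the denominators [k ^ 2] and [(k + 1) ^ 2] in the two
   bounds. *)
pose q k : R := k%:R / k.+1%:R.
have ql : q @ \oo --> (1 : R).
  have -> : q = (fun k => 1 - k.+1%:R^-1).
    apply/funext => k; rewrite /q -natr1; field.
    by rewrite natr1 pnatr_eq0.
  rewrite -[X in _ --> X]subr0; apply: cvgB; [exact: cvg_cst|exact: cvg_harmonic].
have L : (fun k => A k * (q k * q k)) @ \oo --> l.
  rewrite -[X in _ --> X]mulr1 -[X in _ * X]mulr1.
  by apply: cvgM => //; exact: cvgM.
have U : (fun k => A k.+1 * ((q k)^-1 * (q k)^-1)) @ \oo --> l.
  have qV : (fun k => (q k)^-1) @ \oo --> (1 : R).
    by rewrite -[X in _ --> X]invr1; apply: cvgV => //; exact: oner_neq0.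
  rewrite -[X in _ --> X]mulr1 -[X in _ * X]mulr1.
  by apply: cvgM => //; exact: cvgM.
apply: (@squeeze_cvgr _ _ _ _ ((fun k => A k * (q k * q k)) \o K)
   ((fun k => A k.+1 * ((q k)^-1 * (q k)^-1)) \o K)); last 2 first.
- exact: cvg_comp Koo L.
- exact: cvg_comp Koo U.
near=> n.
have K1 : (0 < K n)%N by near: n; have /cvgnyPge := Koo; apply.
have /andP[kn nk] := Kn n; rewrite /=; move: (K n) K1 kn nk => k k0 kn nk.
have n0 : (0 < n)%N by apply: leq_trans kn; rewrite expn_gt0 k0.
have kR : k%:R != 0 :> R by rewrite pnatr_eq0 -lt0n.
have k1R : k%:R + 1 != 0 :> R by rewrite natr1 pnatr_eq0.
have -> : A k * (q k * q k) = u (k ^ 2)%N / (k.+1 ^ 2)%:R.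
  by rewrite /A /q !natrX -natr1; field; rewrite k1R kR.
have -> : A k.+1 * ((q k)^-1 * (q k)^-1) = u (k.+1 ^ 2)%N / (k ^ 2)%:R.
  by rewrite /A /q !natrX -natr1; field; rewrite k1R kR.
apply/andP; split; apply: ler_pM => //; rewrite ?invr_ge0 ?ler0n//.
- exact: uh.
- by rewrite lef_pV2 ?posrE ?ltr0n ?expn_gt0// ler_nat ltnW.
- exact/uh/ltnW.
- by rewrite lef_pV2 ?posrE ?ltr0n ?expn_gt0 ?k0// ler_nat.
Unshelve. all: by end_near. Qed.

(** * Simple paths in the ladder *)

(** Optimal weight over paths that never move left: column [n] is entered in row [b], or in the
    other row before its rung is crossed. *)
Fixpoint ladder_dist {R : realType} (w : ledge -> R) (n : nat) (b : bool) : R :=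
  if n is m.+1 then
    Num.min (ladder_dist w m b + w (inl (b, m)))
            (ladder_dist w m (~~ b) + w (inl (~~ b, m)) + w (inr n))
  else if b then w (inr 0%N) else 0.

Lemma lvertex_flipF (i : nat) (b : bool) : ((i, ~~ b) == (i, b) :> lvertex) = false.
Proof. by apply/eqP; case: b. Qed.

Lemma path_weight_rcons {R : realType} (w : ledge -> R) s p x :
  path_weight w s (rcons p x) = path_weight w s p + w (ledge_of (last s p) x).
Proof. by rewrite /path_weight -cats1 pairmap_cat big_cat/= big_seq1. Qed.

Lemma ladder_dist_attained {R : realType} (w : ledge -> R) (n : nat) (b : bool) :
  exists p : seq lvertex,
    [/\ path (ladj n) (0%N, false) p, all (fun u => u.1 <= n)%N ((0%N, false) :: p),
      uniq ((0%N, false) :: p), last (0%N, false) p = (n, b) &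
      path_weight w (0%N, false) p = ladder_dist w n b].
Proof.
elim: n b => [|n IH] b.
  case: b; last by exists [::]; split; rewrite // /path_weight big_nil.
  by exists [:: (0%N, true)]; split; rewrite // /path_weight big_seq1.
(* The path arrives along row [c] without having visited the other vertex of the column, so that the
   rung can still be appended. *)
have step c : exists p : seq lvertex,
    [/\ path (ladj n.+1) (0%N, false) p, all (fun u => u.1 <= n.+1)%N ((0%N, false) :: p),
      uniq [:: (n.+1, ~~ c), (0%N, false) & p], last (0%N, false) p = (n.+1, c) &
      path_weight w (0%N, false) p = ladder_dist w n c + w (inl (c, n))].
  have [p [pp pn pu pl pw]] := IH c.
  have nin c' : (n.+1, c') \notin (0%N, false) :: p.
    by apply/negP => /(allP pn) /=; rewrite ltnn.
  exists (rcons p (n.+1, c)); split.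
  - rewrite rcons_path pl (sub_path _ pp)/=; last first.
      by move=> x y /and3P[xn yn h]; apply/and3P; split; rewrite // ltnW.
    by rewrite /ladj /= leqnSn leqnn !eqxx.
  - apply/allP => u; rewrite -rcons_cons mem_rcons in_cons.
    by move=> /predU1P[->//|/(allP pn)/leqW].
  - rewrite -rcons_cons cons_uniq rcons_uniq nin pu mem_rcons in_cons negb_or nin andbT.
    by rewrite lvertex_flipF.
  - by rewrite last_rcons.
  - by rewrite path_weight_rcons pl pw /ledge_of /= eqxx (minn_idPl (leqnSn n)).
have [le|le] := leP (ladder_dist w n b + w (inl (b, n)))
  (ladder_dist w n (~~ b) + w (inl (~~ b, n)) + w (inr n.+1)).
  have [p [pp pn /andP[_ pu] pl pw]] := step b.
  by exists p; split => //=; rewrite pw min_l.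
have [p [pp pn /andP[nin pu] pl pw]] := step (~~ b).
rewrite negbK in nin.
exists (rcons p (n.+1, b)); split.
- by rewrite rcons_path pl pp /ladj /= leqnn !eqxx; case: b {le pl pw nin}.
- apply/allP => u; rewrite -rcons_cons mem_rcons in_cons.
  by move=> /predU1P[->//|/(allP pn)].
- by rewrite -rcons_cons rcons_uniq nin.
- by rewrite last_rcons.
- by rewrite path_weight_rcons pl pw /ledge_of /= min_r ?ltW//; case: b {le pl pw nin}.
Qed.

Lemma ladj_path_le (n : nat) (s : lvertex) (p : seq lvertex) :
  path (ladj n) s p -> (s.1 <= n)%N -> all (fun u => u.1 <= n)%N (s :: p).
Proof.
elim: p s => [|y p IH] s /=; first by move=> _ ->.
by move=> /andP[/and3P[sn yn _] /IH /(_ yn)] /=; rewrite sn.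
Qed.

(* Once a simple path moves to the left, it has visited both vertices of some column and
   can never cross it again: this is the second alternative. *)
Lemma ladder_dist_le {R : realType} (w : ledge -> R) (n : nat) (p : seq lvertex)
    (s := (0%N, false) : lvertex) (x := last s p) :
  path (ladj n) s p -> uniq (s :: p) ->
  [/\ all (fun u => u.1 <= x.1)%N (s :: p), ladder_dist w x.1 x.2 <= path_weight w s p &
    (x.1, ~~ x.2) \in s :: p \/
    [/\ (x.1, ~~ x.2) \notin s :: p,
        ladder_dist w x.1 (~~ x.2) <= path_weight w s p + w (inr x.1) &
        (0 < x.1)%N -> (x.1.-1, x.2) \in s :: p]] \/
  exists i, [/\ (x.1 < i)%N, (i, false) \in s :: p & (i, true) \in s :: p].
Proof.
rewrite {}/x; elim/last_ind: p => [|p y IH].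
  move=> _ _; left; split => //=; first by rewrite /path_weight big_nil.
  by right; split; rewrite // /path_weight big_nil add0r.
rewrite rcons_path -rcons_cons rcons_uniq last_rcons path_weight_rcons.
case: (last s p) (mem_last s p) IH => i b xin IH.
case: y => j c /andP[pp adj] /andP[nin pu].
have memr u : u \in s :: p -> u \in rcons (s :: p) (j, c).
  by move=> us; rewrite mem_rcons in_cons us orbT.
case: (IH pp pu) => {IH} /= [[all_i Wv alt]|[k [ik k0 k1]]]; last first.
  right; exists k; split; rewrite ?memr//.
  (* Both vertices of column [k] are already visited, so the path stays to its left. *)
  have jk : j != k.
    by apply: contraNneq nin => ->; case: c {adj memr}.
  rewrite ltn_neqAle jk /=.
  move: adj => /and3P[_ _] /= /orP[/andP[_ /orP[/eqP<-//|/eqP ji]]|/andP[/eqP<- _]].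
    by rewrite -ji in ik; exact: ltnW (ltnW ik).
  exact: ltnW.
move: adj => /and3P[/= _ _ /orP[/andP[/eqP bc /orP[/eqP ji|/eqP ji]]|/andP[/eqP ij bc]]].
- subst c j; left.
  have nc c' : (i.+1, c') \notin s :: p.
    by apply/negP => /(allP all_i) /=; rewrite ltnn.
  have we : w (ledge_of (i, b) (i.+1, b)) = w (inl (b, i)).
    by rewrite /ledge_of /= eqxx (minn_idPl (leqnSn i)).
  rewrite we; split.
  + apply/allP => u; rewrite mem_rcons in_cons.
    by move=> /predU1P[->//|/(allP all_i)/leqW].
  + by rewrite ge_min lerD2r Wv.
  + right; split.
    * rewrite -rcons_cons mem_rcons in_cons negb_or nc andbT.
      by rewrite lvertex_flipF.
    * by rewrite /= negbK ge_min !lerD2r Wv orbT.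
    * by move=> _; exact: memr.
(* A move to the left is new only if the column being left was entered from its other vertex; that
   column is then fully visited. *)
- subst c i; case: alt => [alt|[_ _ /(_ isT) /= alt]]; last first.
    by rewrite alt in nin.
  right; exists j.+1; move: (memr _ xin) (memr _ alt); clear.
  by case: b => /= h1 h2; split.
- subst j.
  have cb : c = ~~ b by move: bc; clear; case: b; case: c.
  subst c; left; rewrite negbK.
  have we : w (ledge_of (i, b) (i, ~~ b)) = w (inr i).
    by rewrite /ledge_of /=; clear; case: b.
  rewrite we; case: alt => [alt|[_ h _]]; first by rewrite alt in nin.
  split => //.
    apply/allP => u; rewrite mem_rcons in_cons.
    by move=> /predU1P[->//|/(allP all_i)].
  by left; exact: memr.
Qed.

Lemma ladder_passageE {R : realType} (w : ledge -> R) (n : nat) :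
  ladder_passage w n = ladder_dist w n false.
Proof.
have [p [pp pn pu pl pw]] := ladder_dist_attained w n false.
rewrite /ladder_passage; set A := (X in inf X).
have Ap : A (ladder_dist w n false).
  by exists p => //=; rewrite /ladder_path pp pl eqxx pu.
have lbA : lbound A (ladder_dist w n false).
  move=> _ [q /and3P[qq /eqP ql qu] <-].
  have := ladder_dist_le w n q qq qu; rewrite ql /= => -[[]//|[i [ni i0 _]]].
  (* The blocking column would lie beyond column [n], which [G_n] does not contain. *)
  by have /allP/(_ _ i0) := ladj_path_le _ _ _ qq (leq0n n); rewrite /= leqNgt ni.
apply/eqP; rewrite eq_le; apply/andP; split.
  by apply: ge_inf => //; exists (ladder_dist w n false).
by apply: lb_le_inf => //; exists (ladder_dist w n false).
Qed.

(** * The potential of the clamped random walk *)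

(** The conditional means have different formulas on the two sides of a point. At [a] both
    difference quotients tend to the same limit, hence so does the glued one. *)
Lemma is_derive_glue (R : realType) (f h f' h' : R -> R) (a : R) :
  (forall x : R, is_derive x 1 f (f' x)) -> (forall x : R, is_derive x 1 h (h' x)) ->
  f a = h a -> f' a = h' a ->
  forall x : R, is_derive x 1 (fun x => if a <= x then f x else h x)
                    (if a <= x then f' x else h' x).
Proof.
move=> df dh fh f'h' x.
have [ax|xa|<-{x}] := ltgtP a x.
- rewrite -[f' x]/(id (f' x)); apply: (near_eq_is_derive _ (df x)).
  near=> y; rewrite ifT//; apply: ltW; near: y; exact: lt_nbhsr.
- apply: (near_eq_is_derive _ (dh x)).
  near=> y; rewrite ifN// -ltNge; near: y; exact: lt_nbhsl.
pose q (p : R -> R) (t : R) := t^-1 *: ((p \o shift a) (t *: (1 : R)) - p a).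
have quot (p p' : R -> R) : (forall x : R, is_derive x 1 p (p' x)) ->
    q p @ 0^' --> p' a.
  move=> dp; have := @ex_derive _ _ _ _ _ _ _ (dp a).
  have <- := @derive_val _ _ _ _ _ _ _ (dp a).
  by [].
set F := (fun x => _).
have qF : q F @ 0^' --> f' a.
  apply/cvgrPdist_lt => e e0.
  have /cvgrPdist_lt/(_ _ e0) qf := quot _ _ df.
  have /cvgrPdist_lt/(_ _ e0) qh := quot _ _ dh.
  near=> t.
  have -> : q F t = if a <= t *: 1 + a then q f t else q h t.
    by rewrite /q /F /= lexx; case: ifP => // _; rewrite fh.
  case: ifP => _; first by near: t; exact: qf.
  rewrite f'h'; near: t; exact: qh.
apply: DeriveDef; first by apply/cvg_ex; exists (f' a); exact: qF.
exact: (cvg_lim (@norm_hausdorff _ _) qF).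
Unshelve. all: by end_near. Qed.

(** The terms of the series of [J_nu(2)], where the power of [x / 2] is 1; for [nu = 2] they are the
    [alpha_k]. *)
Definition bessel_coef {R : realType} (nu k : nat) : R :=
  (-1) ^+ k / ((k`!)%:R * ((k + nu)`!)%:R).

Lemma bessel_coef2S (R : realType) (k : nat) : bessel_coef 2 k.+1 =
  - bessel_coef 2 k / (k.+1%:R * k.+3%:R) :> R.
Proof.
have h n : (n`!)%:R != 0 :> R by rewrite pnatr_eq0 -lt0n fact_gt0.
have hS n : n.+1%:R != 0 :> R by rewrite pnatr_eq0.
rewrite /bessel_coef addSn !factS !natrM exprS !addn2.
move: (h k) (h k.+2) (hS k) (hS k.+2) ((-1) ^+ k).
move: (k`!%:R : R) (k.+2`!%:R : R) (k.+1%:R : R) (k.+3%:R : R) => a b c e a0 b0 c0 e0 s.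
by field; rewrite a0 b0 c0 e0.
Qed.

Lemma bessel_coef1SS (R : realType) (k : nat) : bessel_coef 1 k.+2 =
  bessel_coef 2 k / (k.+1%:R * k.+2%:R * k.+3%:R) :> R.
Proof.
have h n : (n`!)%:R != 0 :> R by rewrite pnatr_eq0 -lt0n fact_gt0.
have hS n : n.+1%:R != 0 :> R by rewrite pnatr_eq0.
rewrite /bessel_coef addn1 addn2 (factS k.+2) (factS k.+1) (factS k) !natrM !exprS.
move: (h k) (hS k) (hS k.+1) (hS k.+2) ((-1) ^+ k).
move: (k`!%:R : R) (k.+1%:R : R) (k.+2%:R : R) (k.+3%:R : R) => a b c e a0 b0 c0 e0 s.
by field; rewrite a0 b0 c0 e0.
Qed.

(* For independent exponential [X] and [Y], [laplace_X lam s] and [laplace_XY lam d] are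
   the means of [e^(-lam |s - X|)] and [e^(-lam |d + Y - X|)]. *)
Definition laplace_X {R : realType} (lam s : R) : R :=
  if 0 <= s then (2 * lam * expR (- s) - (lam + 1) * expR (- (lam * s))) / (lam ^+ 2 - 1)
  else expR (lam * s) / (1 + lam).

Definition laplace_XY {R : realType} (lam d : R) : R :=
  if 0 <= d then (lam * expR (- d) - expR (- (lam * d))) / (lam ^+ 2 - 1)
  else (lam * expR d - expR (lam * d)) / (lam ^+ 2 - 1).

(** The mean of [f (s - X)] is the integral of [f u e^(u - s)] over [u <= s], so subtracting an
    exponential variable gives [m' = f - m]; adding one gives [m' = m - f], as in
    [is_derive_laplace_XY]. *)
Lemma is_derive_laplace_X (R : realType) (lam x : R) : 1 < lam ->
  is_derive x 1 (laplace_X lam) (expR (- (lam * `|x|)) - laplace_X lam x).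
Proof.
move=> lam1.
have l1 : lam ^+ 2 - 1 != 0 by rewrite gt_eqF// subr_gt0 exprn_egt1.
have l2 : 1 + lam != 0 by rewrite gt_eqF//; lra.
apply: is_derive_eq.
  apply: (is_derive_glue _ _ _
    (fun s => (- (2 * lam * expR (- s)) + lam * (lam + 1) * expR (- (lam * s))) / (lam ^+ 2 - 1))
    (fun s => lam * expR (lam * s) / (1 + lam))).
  - move=> s; apply: is_derive_eq.
    rewrite /GRing.scale /=; field. by [].
  - move=> s; apply: is_derive_eq.
    rewrite /GRing.scale /=; field. by [].
  - by rewrite oppr0 !mulr0 oppr0 expR0; field; rewrite l1 l2.
  - by rewrite oppr0 !mulr0 oppr0 expR0; field; rewrite l1 l2.
rewrite /laplace_X; case: ifPn => x0.
  by rewrite ger0_norm//; field.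
by rewrite ltr0_norm ?ltNge// mulrN opprK; field.
Qed.

Lemma is_derive_laplace_XY (R : realType) (lam x : R) : 1 < lam ->
  is_derive x 1 (laplace_XY lam) (laplace_XY lam x - laplace_X lam x).
Proof.
move=> lam1.
have l1 : lam ^+ 2 - 1 != 0 by rewrite gt_eqF// subr_gt0 exprn_egt1.
have l2 : 1 + lam != 0 by rewrite gt_eqF//; lra.
apply: is_derive_eq.
  apply: (is_derive_glue _ (fun d => (lam * expR (- d) - expR (- (lam * d))) / (lam ^+ 2 - 1))
    (fun d => (lam * expR d - expR (lam * d)) / (lam ^+ 2 - 1))
    (fun s => (- (lam * expR (- s)) + lam * expR (- (lam * s))) / (lam ^+ 2 - 1))
    (fun s => (lam * expR s - lam * expR (lam * s)) / (lam ^+ 2 - 1)) 0).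
  - move=> s; apply: is_derive_eq.
    by rewrite /GRing.scale /=; field.
  - move=> s; apply: is_derive_eq.
    by rewrite /GRing.scale /=; field.
  - by rewrite oppr0 !mulr0 oppr0 expR0.
  - by rewrite oppr0 !mulr0 oppr0 expR0; field.
by rewrite /laplace_X /laplace_XY; case: ifPn => x0; field; rewrite ?l1 ?l2.
Qed.

(* The means of [X + min 0 (s - X)] and [X + min 0 (d + Y - X)]. *)
Definition clamp_X {R : realType} (s : R) : R := if 0 <= s then 1 - expR (- s) else s.

Definition clamp_XY {R : realType} (d : R) : R :=
  if 0 <= d then 1 - expR (- d) / 2 else 1 + d - expR d / 2.

Lemma is_derive_clamp_X (R : realType) (x : R) :
  is_derive x 1 (@clamp_X R) (Num.min 0 x + 1 - clamp_X x).
Proof.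
apply: is_derive_eq.
  apply: (is_derive_glue _ (fun s => 1 - expR (- s)) id (fun s => expR (- s)) (fun=> 1) 0).
  - by move=> s; apply: is_derive_eq; rewrite /GRing.scale /=; ring.
  - by rewrite oppr0 expR0 subrr.
  - by rewrite oppr0 expR0.
rewrite /clamp_X; case: ifPn => x0; first by rewrite min_l//; ring.
by rewrite min_r ?ltW ?ltNge//; ring.
Qed.

Lemma is_derive_clamp_XY (R : realType) (x : R) :
  is_derive x 1 (@clamp_XY R) (clamp_XY x - clamp_X x).
Proof.
apply: is_derive_eq.
  apply: (is_derive_glue _ (fun s => 1 - expR (- s) / 2) (fun s => 1 + s - expR s / 2)
    (fun s => expR (- s) / 2) (fun s => 1 - expR s / 2) 0).
  - by move=> s; apply: is_derive_eq; rewrite /GRing.scale /=; field.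
  - by move=> s; apply: is_derive_eq; rewrite /GRing.scale /=; field.
  - by rewrite oppr0 expR0 addr0.
  - by rewrite oppr0 expR0; field.
by rewrite /clamp_X /clamp_XY; case: ifPn => x0; field.
Qed.

(* The mean of [e^(-lam (min v (z + Z)))] for [Z] exponential. *)
Definition trunc_Z {R : realType} (lam v z : R) : R :=
  if v <= z then expR (- (lam * v))
  else (expR (- (lam * z)) + lam * expR (- ((lam + 1) * v)) * expR z) / (lam + 1).

Lemma is_derive_trunc_Z (R : realType) (lam v z : R) : 0 < lam ->
  is_derive z 1 (trunc_Z lam v) (trunc_Z lam v z - expR (- (lam * Num.min v z))).
Proof.
move=> lam0.
have l2 : lam + 1 != 0 by rewrite gt_eqF//; lra.
have E : expR (- ((lam + 1) * v)) * expR v = expR (- (lam * v)).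
  by rewrite -expRD; congr expR; ring.
apply: is_derive_eq.
  apply: (is_derive_glue _ (fun=> expR (- (lam * v)))
    (fun z => (expR (- (lam * z)) + lam * expR (- ((lam + 1) * v)) * expR z) / (lam + 1)) (fun=> 0)
    (fun z => (- (lam * expR (- (lam * z))) +
        lam * expR (- ((lam + 1) * v)) * expR z) / (lam + 1)) v).
  - by move=> s; apply: is_derive_eq; rewrite /GRing.scale /=; field.
  - by rewrite -mulrA E; field.
  - by rewrite -mulrA E; field.
rewrite /trunc_Z; case: ifPn => x0; first by rewrite min_l// subrr.
by rewrite min_r ?ltW ?ltNge//; field.
Qed.

Lemma laplace_X_bounded (R : realType) (lam : R) : 1 < lam ->
  exists C, forall s, `|laplace_X lam s| <= C.
Proof.
move=> lam1.
have l1 : 0 < lam ^+ 2 - 1 by rewrite subr_gt0 exprn_egt1.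
have l2 : 0 < 1 + lam by lra.
exists ((2 * lam + (lam + 1)) / (lam ^+ 2 - 1) + 1 / (1 + lam)) => s.
have p1 : 0 <= 1 / (1 + lam) by rewrite divr_ge0// ltW.
have p2 : 0 <= (2 * lam + (lam + 1)) / (lam ^+ 2 - 1) by rewrite divr_ge0 ?ltW//; lra.
rewrite /laplace_X; case: ifPn => s0.
  rewrite -[leLHS]addr0 lerD// normrM normfV (gtr0_norm l1) ler_pM2r ?invr_gt0//.
  apply: (le_trans (ler_normB _ _)).
  have e1 : expR (- s) <= 1 by rewrite -expR0 ler_expR oppr_le0.
  have e2 : expR (- (lam * s)) <= 1 by rewrite -expR0 ler_expR oppr_le0 mulr_ge0//; lra.
  have e3 := expR_ge0 (- s); have e4 := expR_ge0 (- (lam * s)).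
  rewrite !normrM !ger0_norm//; try lra.
  by rewrite lerD// ler_piMr//; lra.
rewrite -[leLHS]add0r lerD// normrM normfV (gtr0_norm l2) ler_pM2r ?invr_gt0//.
rewrite ger0_norm ?expR_ge0// -expR0 ler_expR.
by rewrite pmulr_rle0 ?ltW ?ltNge//; lra.
Qed.

(** [Y - X] is symmetric, so the mean is even in [d] and the drift involves [d] only through
    [e^(-|d|)]. *)
Lemma laplace_XYE (R : realType) (lam d : R) :
  laplace_XY lam d = (lam * expR (- `|d|) - expR (- (lam * `|d|))) / (lam ^+ 2 - 1).
Proof.
rewrite /laplace_XY; case: ifPn => x0; first by rewrite ger0_norm.
by rewrite ltr0_norm ?ltNge// mulrN !opprK.
Qed.

Lemma laplace_XY_bounded (R : realType) (lam : R) : 1 < lam ->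
  exists C, forall s, `|laplace_XY lam s| <= C.
Proof.
move=> lam1.
have l1 : 0 < lam ^+ 2 - 1 by rewrite subr_gt0 exprn_egt1.
exists ((lam + 1) / (lam ^+ 2 - 1)) => s.
rewrite laplace_XYE normrM normfV (gtr0_norm l1) ler_pM2r ?invr_gt0//.
apply: (le_trans (ler_normB _ _)).
have e1 : expR (- `|s|) <= 1 by rewrite -expR0 ler_expR oppr_le0.
have e2 : expR (- (lam * `|s|)) <= 1 by rewrite -expR0 ler_expR oppr_le0 mulr_ge0//; lra.
have e3 := expR_ge0 (- `|s|); have e4 := expR_ge0 (- (lam * `|s|)).
move: (expR (- `|s|)) (expR (- (lam * `|s|))) e1 e2 e3 e4 => a b e1 e2 e3 e4.
rewrite !normrM !ger0_norm//; try lra.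
by rewrite lerD// ler_piMr//; lra.
Qed.

Lemma trunc_Z_bounded (R : realType) (lam : R) : 0 < lam ->
  exists C, forall v z, 0 <= v -> 0 <= z -> `|trunc_Z lam v z| <= C.
Proof.
move=> lam0; exists 1 => v z v0 z0; rewrite /trunc_Z; case: ifPn => vz.
  by rewrite ger0_norm ?expR_ge0// -expR0 ler_expR oppr_le0 mulr_ge0// ltW.
have l2 : 0 < lam + 1 by lra.
rewrite -ltNge in vz.
have e1 : expR (- (lam * z)) <= 1 by rewrite -expR0 ler_expR oppr_le0 mulr_ge0//; lra.
have e2 : expR (- ((lam + 1) * v)) * expR z <= 1.
  rewrite -expRD -[leRHS]expR0 ler_expR mulrDl mul1r.
  by have := mulr_ge0 (ltW lam0) v0; lra.
have e3 := expR_ge0 (- (lam * z)).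
have e4 : 0 <= expR (- ((lam + 1) * v)) * expR z by rewrite mulr_ge0 ?expR_ge0.
rewrite -mulrA; move: (expR (- (lam * z))) (expR (- ((lam + 1) * v)) * expR z) e1 e2 e3 e4.
move=> a b e1 e2 e3 e4.
have b0 : 0 <= lam * b by rewrite mulr_ge0// ltW.
have b1 : lam * b <= lam by rewrite ler_piMr// ltW.
rewrite ger0_norm; last by rewrite divr_ge0 ?addr_ge0// ltW.
by rewrite ler_pdivrMr// mul1r; lra.
Qed.

Lemma clamp_X_bounded (R : realType) (s : R) : `|clamp_X s - Num.min 0 s| <= 1.
Proof.
rewrite /clamp_X; case: ifPn => s0.
  rewrite min_l// subr0 ler_norml.
  have e1 : expR (- s) <= 1 by rewrite -expR0 ler_expR oppr_le0.
  by have e3 := expR_ge0 (- s); apply/andP; split; lra.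
by rewrite -ltNge in s0; rewrite (min_r (ltW s0)) subrr normr0.
Qed.

(** Isolates [1 - e^(-|d|) / 2], the mean increase of min(a_n, b_n) when D_n = d. *)
Lemma clamp_XYE (R : realType) (d : R) :
  clamp_XY d = Num.min 0 d + 1 - expR (- `|d|) / 2.
Proof.
rewrite /clamp_XY; case: ifPn => s0; first by rewrite min_l// ger0_norm// add0r.
by rewrite min_r ?ltW ?ltNge// ltr0_norm ?ltNge// opprK (addrC d).
Qed.

Lemma clamp_XY_bounded (R : realType) (d : R) : `|clamp_XY d - Num.min 0 d| <= 1.
Proof.
rewrite clamp_XYE ler_norml.
have e1 : expR (- `|d|) <= 1 by rewrite -expR0 ler_expR oppr_le0.
by have e3 := expR_ge0 (- `|d|); apply/andP; split; lra.
Qed.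

(* An approximate solution of Poisson's equation with constant [chi] and error [eps],
   together with its conditional means when [Y], [X] and [Z] are revealed in this order:
   with [w = d + Y - X] and [s = d + Y],
   [pot_Z |w| = E (pot (min |w| Z))], [pot_X s = E (X + min 0 w + pot_Z |w|)] and
   [pot_XY d = E (pot_X s)].  The means are encoded by the differential equations
   required in [integral_exponential_law_cert]. *)
Record ladder_potential (R : realType) (chi eps : R) := LadderPotential {
  pot : R -> R;
  pot_Z : R -> R;
  pot_X : R -> R;
  pot_XY : R -> R;
  cert_Z : R -> R -> R;
  pot_bound : R;
  pot_bound_ge0 : 0 <= pot_bound;
  continuous_pot : continuous pot;
  continuous_pot_Z : continuous pot_Z;
  pot_bounded : forall x, 0 <= x -> `|pot x| <= pot_bound;
  pot_Z_bounded : forall x, 0 <= x -> `|pot_Z x| <= pot_bound;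
  pot_X_bounded : forall x, `|pot_X x - Num.min 0 x| <= pot_bound;
  pot_XY_bounded : forall x, `|pot_XY x - Num.min 0 x| <= pot_bound;
  cert_Z_bounded : forall v z, 0 <= v -> 0 <= z -> `|cert_Z v z| <= pot_bound;
  cert_Z0 : forall v, 0 <= v -> cert_Z v 0 = 0;
  is_derive_cert_Z : forall v z : R, 0 <= v ->
    is_derive z 1 (cert_Z v) (cert_Z v z - (pot (Num.min v z) - pot_Z v));
  is_derive_pot_X : forall x : R,
    is_derive x 1 pot_X (Num.min 0 x + pot_Z `|x| + 1 - pot_X x);
  is_derive_pot_XY : forall x : R, is_derive x 1 pot_XY (pot_XY x - pot_X x);
  pot_drift : forall x, `|pot_XY x - (Num.min 0 x + pot `|x| + chi)| <= eps
}.

(** The coefficients survive averaging, since the mean of [1 - F] is 1 minus the mean of [F]; thus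
    the potential and its conditional means are all mixtures. *)
Definition mixture {R : realType} {U : Type} (K : nat) (a : nat -> R)
    (F : nat -> U -> R) (x : U) : R :=
  \sum_(k < K) a k * (1 - F k x).

Lemma is_derive_mixture (R : realType) (K : nat) (a : nat -> R) (F : nat -> R -> R)
    (F' : nat -> R) (x : R) :
  (forall k, is_derive x 1 (F k) (F' k)) ->
  is_derive x 1 (mixture K a F) (- \sum_(k < K) a k * F' k).
Proof.
move=> dF; elim: K => [|K IH].
  have -> : mixture 0 a F = cst 0 by apply/funext => y; rewrite /mixture big_ord0.
  by rewrite big_ord0 oppr0; exact: is_derive_cst.
have -> : mixture K.+1 a F = (fun y => mixture K a F y + a K * (1 - F K y)).
  by apply/funext => y; rewrite /mixture big_ord_recr.
have dFK := dF K.
apply: is_derive_eq; rewrite big_ord_recr /GRing.scale /=; ring.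
Qed.

Lemma mixtureB (R : realType) (U V : Type) (K : nat) (a : nat -> R) (F : nat -> U -> R)
    (G : nat -> V -> R) (x : U) (y : V) :
  mixture K a F x - mixture K a G y = - \sum_(k < K) a k * (F k x - G k y).
Proof.
by rewrite /mixture -sumrB -sumrN; apply: eq_bigr => k _; ring.
Qed.

Lemma mixture_bounded (R : realType) (U : Type) (D : U -> Prop) (K : nat)
    (a : nat -> R) (F : nat -> U -> R) :
  (forall k, exists C, forall x, D x -> `|F k x| <= C) ->
  exists2 C, 0 <= C & forall x, D x -> `|mixture K a F x| <= C.
Proof.
move=> FC; elim: K => [|K [C C0 IH]].
  by exists 0 => // x _; rewrite /mixture big_ord0 normr0.
have [C' FC'] := FC K.
exists (C + `|a K| * (1 + `|C'|)) => [|x Dx].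
  by rewrite addr_ge0// mulr_ge0// addr_ge0.
rewrite /mixture big_ord_recr; apply: (le_trans (ler_normD _ _)).
rewrite lerD ?IH// normrM ler_wpM2l//; apply: (le_trans (ler_normB _ _)).
by rewrite normr1 lerD2l (le_trans (FC' _ Dx))// ler_norm.
Qed.

Lemma expRN_bounded (R : realType) (lam x : R) : 0 <= lam -> 0 <= x ->
  `|expR (- (lam * x))| <= 1.
Proof.
by move=> l0 x0; rewrite ger0_norm ?expR_ge0// -[leRHS]expR0 ler_expR oppr_le0 mulr_ge0.
Qed.

(* With [t = e^(-|d|)], all the terms telescope because of [bessel_coef2S], except for
   one in [t], cancelled by [clamp_XY] when [2 c] is the inverse of the partial sum, and
   one in [t ^ (K+1)], which is the error of truncation. *)
Lemma bessel_drift_identity (R : realType) (K : nat) (c t : R) :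
  \sum_(k < K) c * bessel_coef 2 k / k.+2%:R *
      (1 - (k.+2%:R * t - t ^+ k.+2) / (k.+2%:R ^+ 2 - 1)) -
  \sum_(k < K) c * bessel_coef 2 k / k.+1%:R * (1 - t ^+ k.+1) =
  - c * (\sum_(k < K.+2) bessel_coef 1 k - \sum_(k < K.+1) bessel_coef 2 k) +
  c * t * (\sum_(k < K.+1) bessel_coef 2 k) - c * bessel_coef 2 K / K.+1%:R * t ^+ K.+1.
Proof.
elim: K => [|K IH].
  by rewrite !big_ord0 !big_ord_recr !big_ord0 /= /bessel_coef /= !factS fact0; field.
move: IH; rewrite (big_ord_recr K.+2) /=.
set B := \sum_(k < K.+2) _; rewrite (big_ord_recr K.+1) /=.
set A := \sum_(k < K.+1) bessel_coef 2 k.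
rewrite [in X in _ -> X]big_ord_recr /= [X in _ -> _ - X = _]big_ord_recr /=.
set S1 := \sum_(k < K) _; set S2 := \sum_(k < K) _ => IH.
have -> (x y : R) : S1 + x - (S2 + y) = (S1 - S2) + x - y by ring.
rewrite IH bessel_coef1SS bessel_coef2S !exprS.
have h1 : (K%:R : R) + 1 != 0 by rewrite natr1 pnatr_eq0.
have h2 : (K%:R : R) + 2 != 0 by rewrite -natrD addn2 pnatr_eq0.
have h3 : (K%:R : R) + 3 != 0 by rewrite -natrD addn3 pnatr_eq0.
have -> : K.+3%:R = K%:R + 3 :> R by rewrite -natrD addn3.
have -> : K.+2%:R = K%:R + 2 :> R by rewrite -natrD addn2.
have -> : K.+1%:R = K%:R + 1 :> R by rewrite natr1.
(* At rate [K + 2] the denominator [lam ^ 2 - 1] is [(K + 1) (K + 3)], the product in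
   [bessel_coef2S]; hence the telescoping. *)
have h4 : (K%:R + 2) ^+ 2 - 1 != 0 :> R.
  have -> : (K%:R + 2) ^+ 2 - 1 = (K%:R + 1) * (K%:R + 3) :> R by ring.
  by rewrite mulf_neq0.
field; rewrite h1 h2 h3 //=.
Qed.

Lemma exists_ladder_potential (R : realType) (K : nat)
    (A := \sum_(k < K.+1) bessel_coef 2 k : R) (B := \sum_(k < K.+2) bessel_coef 1 k : R) :
  0 < A ->
  inhabited (ladder_potential R (3 / 2 - B / (2 * A)) (`|bessel_coef 2 K| / (2 * A))).
Proof.
move=> A0.
have nS n : n.+1%:R != 0 :> R by rewrite pnatr_eq0.
(* [b] integrates the truncated series: [H] has derivative [c * sum_k alpha_k e^(-(k+1)x)].
   Averaging over [Z] multiplies a coefficient by [(k+1)/(k+2)] and raises the rate to [k+2], which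
   gives [a] and [phi]. *)
pose c := (2 * A)^-1.
pose a k := c * bessel_coef 2 k / k.+2%:R.
pose b k := c * bessel_coef 2 k / k.+1%:R.
pose H := mixture K b (fun k x => expR (- (k.+1%:R * x))).
pose phi := mixture K a (fun k x => expR (- (k.+2%:R * x))).
pose mX := mixture K a (fun k => laplace_X k.+2%:R).
pose mXY := mixture K a (fun k => laplace_XY k.+2%:R).
pose mZ v := mixture K b (fun k => trunc_Z k.+1%:R v).
have lam1 k : 1 < k.+2%:R :> R by rewrite ltr1n.
have lam0 k : 0 < k.+1%:R :> R by rewrite ltr0n.
have [|C1 C10 HC] := mixture_bounded R R (fun x => 0 <= x) K b (fun k x => expR (- (k.+1%:R * x))).
  by move=> k; exists 1 => x; exact: expRN_bounded.
have [|C2 C20 phiC] := mixture_bounded R R (fun x => 0 <= x) K a (fun k x => expR (- (k.+2%:R * x))).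
  by move=> k; exists 1 => x; exact: expRN_bounded.
have [|C3 C30 mXC] := mixture_bounded R R (fun=> True) K a (fun k => laplace_X k.+2%:R).
  by move=> k; have [C hC] := laplace_X_bounded _ _ (lam1 k); exists C.
have [|C4 C40 mXYC] := mixture_bounded R R (fun=> True) K a (fun k => laplace_XY k.+2%:R).
  by move=> k; have [C hC] := laplace_XY_bounded _ _ (lam1 k); exists C.
have [|C5 C50 mZC] := mixture_bounded R (R * R) (fun x => 0 <= x.1 /\ 0 <= x.2) K b
    (fun k x => trunc_Z k.+1%:R x.1 x.2).
  move=> k; have [C hC] := trunc_Z_bounded _ _ (lam0 k); exists C => -[v z] [] /=; exact: hC.
split; apply: (@LadderPotential _ _ _ H phi (fun s => clamp_X s + mX s)
  (fun d => clamp_XY d + mXY d) (fun v z => mZ v z - phi v) (1 + C1 + C2 + C3 + C4 + C5)).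
- lra.
- move=> x; apply: differentiable_continuous; apply/derivable1_diffP.
  apply: ex_derive; apply: is_derive_mixture => k; exact: is_derive_eq.
- move=> x; apply: differentiable_continuous; apply/derivable1_diffP.
  apply: ex_derive; apply: is_derive_mixture => k; exact: is_derive_eq.
- by move=> x /HC hx; apply: (le_trans hx); lra.
- by move=> x /phiC hx; apply: (le_trans hx); lra.
- move=> x; rewrite addrAC; apply: (le_trans (ler_normD _ _)).
  have h1 := clamp_X_bounded _ x; have h2 := mXC x I; rewrite -/(mX x) in h2; lra.
- move=> x; rewrite addrAC; apply: (le_trans (ler_normD _ _)).
  have h1 := clamp_XY_bounded _ x; have h2 := mXYC x I; rewrite -/(mXY x) in h2; lra.
- move=> v z v0 z0; apply: (le_trans (ler_normB _ _)).
  have := phiC _ v0; have := mZC (v, z) (conj v0 z0).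
  rewrite -/(phi v) -[mixture _ _ _ (v, z)]/(mZ v z); lra.
- move=> v v0; apply/eqP; rewrite subr_eq0; apply/eqP; apply: eq_bigr => k _.
  rewrite /trunc_Z mulr0 oppr0 expR0 mulr1 /a /b; case: ifPn => [v0'|_].
    have -> : v = 0 by apply/eqP; rewrite eq_le v0' v0.
    by rewrite !mulr0 oppr0 expR0 !subrr !mulr0.
  have -> : k.+1%:R + 1 = k.+2%:R :> R by rewrite natr1.
  move: (expR _) (nS k) (nS k.+1); have -> : k.+2%:R = k.+1%:R + 1 :> R by rewrite natr1.
  by move: (k.+1%:R : R) => y e y0 y1; field; rewrite y0 y1.
- move=> v z v0; have dm := is_derive_mixture R K b (fun k => trunc_Z k.+1%:R v) _ z
    (fun k => is_derive_trunc_Z _ _ v z (lam0 k)).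
  have dZ : is_derive z 1 (mZ v) (mZ v z - H (Num.min v z)).
    by apply: (is_derive_eq dm); rewrite /mZ /H mixtureB.
  by apply: is_derive_eq; ring.
- move=> x; have dm := is_derive_mixture R K a (fun k => laplace_X k.+2%:R) _ x
    (fun k => is_derive_laplace_X _ _ x (lam1 k)).
  have dc := is_derive_clamp_X _ x.
  have dX : is_derive x 1 mX (phi `|x| - mX x).
    by apply: (is_derive_eq dm); rewrite /mX /phi mixtureB.
  by apply: is_derive_eq; ring.
- move=> x; have dm := is_derive_mixture R K a (fun k => laplace_XY k.+2%:R) _ x
    (fun k => is_derive_laplace_XY _ _ x (lam1 k)).
  have dc := is_derive_clamp_XY _ x.
  have dXY : is_derive x 1 mXY (mXY x - mX x).
    by apply: (is_derive_eq dm); rewrite /mX /mXY mixtureB.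
  by apply: is_derive_eq; ring.
- move=> x; pose t := expR (- `|x|).
  have tk k : expR (- (k%:R * `|x|)) = t ^+ k by rewrite -mulrN expRM_natl.
  have mXYE : mXY x = \sum_(k < K) c * bessel_coef 2 k / k.+2%:R *
      (1 - (k.+2%:R * t - t ^+ k.+2) / (k.+2%:R ^+ 2 - 1)).
    by apply: eq_bigr => k _; rewrite laplace_XYE tk.
  have HE : H `|x| = \sum_(k < K) c * bessel_coef 2 k / k.+1%:R * (1 - t ^+ k.+1).
    by apply: eq_bigr => k _; rewrite tk.
  have := bessel_drift_identity R K c t; rewrite -mXYE -HE -/A -/B => key.
  (* Since [c * A = 1 / 2], the terms in [t] cancel and the constant is
     [1 - c * (B - A) = 3 / 2 - B / (2 * A)]; only the truncation term remains. *)
  have -> : clamp_XY x + mXY x - (Num.min 0 x + H `|x| + (3 / 2 - B / (2 * A))) =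
     - (c * bessel_coef 2 K / K.+1%:R * t ^+ K.+1).
    rewrite clamp_XYE -/t (_ : mXY x = mXY x - H `|x| + H `|x|); last by ring.
    by rewrite key /c; field; rewrite (gt_eqF A0) addrC natr1 nS.
  have t0 : 0 <= t by exact: expR_ge0.
  have t1 : t <= 1 by rewrite /t -expR0 ler_expR oppr_le0.
  pose p := t ^+ K.+1 / K.+1%:R.
  have p0 : 0 <= p by rewrite divr_ge0 ?exprn_ge0.
  have p1 : p <= 1.
    by rewrite mulr_ile1 ?exprn_ge0 ?invr_ge0 ?exprn_ile1// invf_le1 ?ler1n.
  have c0 : 0 < c by rewrite invr_gt0 mulr_gt0.
  rewrite (_ : _ * t ^+ K.+1 = c * bessel_coef 2 K * p); last by rewrite /p; ring.
  clearbody p; rewrite normrN !normrM (ger0_norm p0) (gtr0_norm c0) (mulrC c).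
  by rewrite ler_piMr ?mulr_ge0// ltW.
Qed.
Arguments pot {R chi eps}.
Arguments pot_Z {R chi eps}.
Arguments pot_X {R chi eps}.
Arguments pot_XY {R chi eps}.
Arguments cert_Z {R chi eps}.
Arguments pot_bound {R chi eps}.
Arguments pot_bound_ge0 {R chi eps}.
Arguments continuous_pot {R chi eps}.
Arguments continuous_pot_Z {R chi eps}.
Arguments pot_bounded {R chi eps}.
Arguments pot_Z_bounded {R chi eps}.
Arguments pot_X_bounded {R chi eps}.
Arguments pot_XY_bounded {R chi eps}.
Arguments cert_Z_bounded {R chi eps}.
Arguments cert_Z0 {R chi eps}.
Arguments is_derive_cert_Z {R chi eps}.
Arguments is_derive_pot_X {R chi eps}.
Arguments is_derive_pot_XY {R chi eps}.
Arguments pot_drift {R chi eps}.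

(** * Bessel series at 2 and limit of the truncated constants *)

Lemma is_cvg_series_bessel_coef (R : realType) (nu : nat) :
  cvgn (series (@bessel_coef R nu)).
Proof.
apply: normed_cvg; apply: (series_le_cvg _ _ _ (@is_cvg_series_exp_coeff R 1)).
- by move=> k; exact: normr_ge0.
- by move=> k; rewrite /exp_coeff /= divr_ge0 ?exprn_ge0.
- move=> k; rewrite /exp_coeff /= /bessel_coef normrM normrX normrN1 !expr1n.
  rewrite normfV ler_wpM2l// ger0_norm ?mulr_ge0// lef_pV2 ?posrE ?mulr_gt0 ?ltr0n ?fact_gt0//.
  by rewrite ler_peMr// ler1n fact_gt0.
Qed.

Lemma besselJ2E (R : realType) (nu : nat) :
  besselJ nu (2 : R) = limn (series (@bessel_coef R nu)).
Proof.
rewrite /besselJ; congr (limn (series _)); apply/funext => k.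
by rewrite divff ?pnatr_eq0// expr1n mulr1.
Qed.

(** By [bessel_coef2S] consecutive terms have ratio at most [1 / 3] in absolute value, and the first
    term is [1 / 2]. *)
Lemma bessel_coef2_le (R : realType) (k : nat) :
  `|bessel_coef 2 k| <= 2^-1 * (3^-1) ^+ k :> R.
Proof.
elim: k => [|k IH].
  by rewrite /bessel_coef /= !factS fact0 !expr0 ger0_norm; lra.
rewrite bessel_coef2S normrM normrN exprS mulrCA [leRHS]mulrC.
apply: ler_pM => //; rewrite normfV ger0_norm ?mulr_ge0//.
rewrite lef_pV2 ?posrE ?mulr_gt0//.
by rewrite -natrM ler_nat mulSn (leq_trans _ (leq_addr _ _)).
Qed.

(** Keeps the partial sums and [J_2(2)] away from 0. The slack closes the induction: the next term
    is at least [- 2^-1 * 3^-(K+1)], which leaves exactly [4^-1 * 3^-(K+1)]. *)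
Lemma sum_bessel_coef2_ge (R : realType) (K : nat) :
  4^-1 + 4^-1 * (3^-1) ^+ K <= \sum_(k < K.+1) bessel_coef 2 k :> R.
Proof.
elim: K => [|K IH].
  by rewrite big_ord_recr big_ord0 /= /bessel_coef /= !factS fact0 !expr0; lra.
rewrite big_ord_recr /=; have := bessel_coef2_le R K.+1.
rewrite ler_norml !exprS => /andP[h _]; lra.
Qed.

Lemma ladder_constant_cvg (R : realType) :
  (fun K => 3 / 2 - (\sum_(k < K.+2) bessel_coef 1 k) / (2 * \sum_(k < K.+1) bessel_coef 2 k))
    @ \oo --> (3 / 2 - besselJ 1 2 / (2 * besselJ 2 2) : R) /\
  (fun K => `|bessel_coef 2 K| / (2 * \sum_(k < K.+1) bessel_coef 2 k)) @ \oo --> (0 : R).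
Proof.
have A : (fun K => \sum_(k < K.+1) bessel_coef 2 k) @ \oo --> (besselJ 2 2 : R).
  rewrite besselJ2E (_ : (fun K => _) = (fun K => series (@bessel_coef R 2) K.+1)).
    by rewrite (cvg_shiftS (series (@bessel_coef R 2))); exact: is_cvg_series_bessel_coef.
  by apply/funext => K; rewrite /series /= big_mkord.
have B : (fun K => \sum_(k < K.+2) bessel_coef 1 k) @ \oo --> (besselJ 1 2 : R).
  rewrite besselJ2E (_ : (fun K => _) = (fun K => series (@bessel_coef R 1) K.+2)).
    rewrite (cvg_shiftS (fun K => series (@bessel_coef R 1) K.+1)).
    by rewrite (cvg_shiftS (series (@bessel_coef R 1))); exact: is_cvg_series_bessel_coef.
  by apply/funext => K; rewrite /series /= big_mkord.
have J0 : 0 < besselJ 2 2 :> R.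
  apply: (@lt_le_trans _ _ 4^-1) => //.
  rewrite -(cvg_lim (@norm_hausdorff _ _) A); apply: limr_ge; first by apply/cvg_ex; eexists; exact: A.
  apply: nearW => K; apply: le_trans (sum_bessel_coef2_ge R K).
  by rewrite lerDl mulr_ge0// exprn_ge0.
have V : (fun K => (2 * \sum_(k < K.+1) bessel_coef 2 k)^-1) @ \oo --> ((2 * besselJ 2 2)^-1 : R).
  apply: cvgV; first by rewrite mulf_neq0// gt_eqF.
  by apply: cvgMr.
split; first by apply: cvgB; [exact: cvg_cst|exact: cvgM B V].
rewrite -[X in _ --> X](mul0r ((2 * besselJ 2 2)^-1 : R)); apply: cvgM => //.
rewrite -[X in _ --> X](@normr0 _ R); apply: cvg_norm.
exact: cvg_series_cvg_0 (is_cvg_series_bessel_coef R 2).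
Qed.

(** * The martingale *)

(* The first component of [V] is the current value of the walk, the second one is the
   value of the martingale, with second moment at most [q]. *)
Definition markov_state {d} {T : measurableType d} {R : realType} {P : probability T R}
    {I : eqType} (X : I -> {RV P >-> R}) (F : pred I) (V : T -> R * R) (q : R) :=
  [/\ measurable_fun setT V, fresh X F V &
      (\int[P]_x ((V x).2 ^+ 2)%:E <= q%:E)%E].

(** Reveals one edge: [k] updates the walk, and [f] is a martingale increment because the
    certificate [G] vanishes at 0. *)
Lemma markov_state_step {d} {T : measurableType d} {R : realType} {P : probability T R}
    {I : eqType} (X : I -> {RV P >-> R}) (F : pred I) (V : T -> R * R) (q : R) (e : I)
    (k f G : R -> R -> R) (C : R) :
  markov_state X F V q -> F e -> exponential_law (distribution P (X e)) -> 0 <= C ->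
  measurable_fun setT (fun z : R * R => k z.1 z.2) ->
  measurable_fun setT (fun z : R * R => f z.1 z.2) ->
  (forall v, continuous (f v)) ->
  (forall v x, 0 <= x -> `|f v x| <= x + C) ->
  (forall v (x : R), is_derive x 1 (G v) (G v x - f v x)) ->
  (forall v, exists K, forall x, 0 <= x -> `|G v x| <= K * (1 + x) ^+ 2) ->
  (forall v, G v 0 = 0) ->
  markov_state X (predD1 F e)
    (fun x => (k (V x).1 `|X e x|, (V x).2 + f (V x).1 `|X e x|))
    (q + (C ^+ 2 + 2 * C + 2)).
Proof.
move=> [mV XF Vq] Fe Xe C0 mk mf cf fC dG GK G0.
pose V' : {mfun T >-> (R * R)%type} := HB.pack V (isMeasurableFun.Build _ _ _ _ _ mV).
pose st (z : R * R * R) : R * R := (k z.1.1 `|z.2|, z.1.2 + f z.1.1 `|z.2|).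
have mst : measurable_fun setT st.
  have mz : measurable_fun setT (fun z : R * R * R => (z.1.1, `|z.2|)).
    by apply: measurable_fun_pair; [exact: measurableT_comp|exact: measurableT_comp].
  apply: measurable_fun_pair.
    exact: (measurableT_comp mk mz).
  apply: measurable_funD; first exact: measurableT_comp.
  exact: (measurableT_comp mf mz).
have mXe : measurable_fun setT (X e) by exact: measurable_funP.
split.
- have mVX : measurable_fun setT (fun x => (V x, X e x)) by exact: measurable_fun_pair.
  exact: (measurableT_comp mst mVX).
- have XF' := fresh_pair X F V' e XF Fe.
  have := fresh_comp X _ _ _ mst XF'.
  exact.
- have dG' (v : R * R) (x : R) : is_derive x 1 (G v.1) (G v.1 x - f v.1 x) := dG v.1 x.
  have := @fresh_sqr_step _ _ T _ R P I X F V' e snd (fun v => f v.1) (fun v => G v.1) C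
    XF Fe Xe C0 _ _ (fun v => cf v.1) (fun v => fC v.1) dG' (fun v => GK v.1) (fun v => G0 v.1).
  move=> /(_ measurable_snd) /= h; rewrite EFinD; apply: le_trans (leeD2r _ Vq); apply: h.
  have m1 : measurable_fun setT (fun z : R * R * R => (z.1.1, z.2)).
    by apply: measurable_fun_pair => //; exact: measurableT_comp.
  exact: (measurableT_comp mf m1).
Qed.

(* The edges not yet revealed at time [n]. *)
Definition edge_after (n : nat) (e : ledge) : bool :=
  match e with inl (_, i) => (n <= i)%N | inr i => (n < i)%N end.

(* The absolute values are harmless as weights are almost surely nonnegative; they make
   the bounds on the increments hold everywhere. *)
Fixpoint chain_state {R : realType} {chi eps : R} (pt : ladder_potential R chi eps)
    (w : ledge -> R) (n : nat) : R * R :=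
  if n is m.+1 then
    let v := chain_state pt w m in
    let y := `|w (inl (true, m))| in
    let x := `|w (inl (false, m))| in
    let z := `|w (inr n)| in
    let v1 := (v.1 + y, v.2 + (pot_X pt (v.1 + y) - pot_XY pt v.1)) in
    let v2 := (v1.1 - x,
      v1.2 + (x + Num.min 0 (v1.1 - x) + pot_Z pt `|v1.1 - x| - pot_X pt v1.1)) in
    (Num.max (- z) (Num.min v2.1 z),
      v2.2 + (pot pt (Num.min `|v2.1| z) - pot_Z pt `|v2.1|))
  else (`|w (inr 0%N)|, 0).

Lemma min0D_le (R : realType) (s x : R) : 0 <= x ->
  `|Num.min 0 (s + x) - Num.min 0 s| <= x.
Proof.
by move=> x0; rewrite ler_norml !minEle; do 2 case: ifPn => ?; apply/andP; split; lra.
Qed.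

Lemma linear_growth_sqr (R : realType) (C : R) (G : R -> R) : 0 <= C ->
  (forall x, 0 <= x -> `|G x| <= x + C) ->
  exists K, forall x, 0 <= x -> `|G x| <= K * (1 + x) ^+ 2.
Proof. by move=> C0 GC; exists (1 + C) => x x0; apply: (le_trans (GC _ x0)); nra. Qed.

Lemma continuous_pot_X (R : realType) (chi eps : R) (pt : ladder_potential R chi eps) :
  continuous (pot_X pt).
Proof.
move=> x; apply: differentiable_continuous; apply/derivable1_diffP.
exact: (@ex_derive _ _ _ _ _ _ _ (is_derive_pot_X pt x)).
Qed.

Lemma continuous_pot_XY (R : realType) (chi eps : R) (pt : ladder_potential R chi eps) :
  continuous (pot_XY pt).
Proof.
move=> x; apply: differentiable_continuous; apply/derivable1_diffP.
exact: (@ex_derive _ _ _ _ _ _ _ (is_derive_pot_XY pt x)).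
Qed.

(** [pot_XY] is its own certificate, as [pot_XY' = pot_XY - pot_X]. Both functions stay within a
    bounded distance of [min 0], whose increment is at most [y]; hence the linear bound. *)
Lemma markov_state_Y {d} {T : measurableType d} {R : realType} {P : probability T R}
    {I : eqType} (X : I -> {RV P >-> R}) (F : pred I) (V : T -> R * R) (q : R) (e : I)
    (chi eps : R) (pt : ladder_potential R chi eps) (C := 2 * pot_bound pt) :
  markov_state X F V q -> F e -> exponential_law (distribution P (X e)) ->
  markov_state X (predD1 F e)
    (fun x => ((V x).1 + `|X e x|,
      (V x).2 + (pot_X pt ((V x).1 + `|X e x|) - pot_XY pt (V x).1)))
    (q + (C ^+ 2 + 2 * C + 2)).
Proof.
move=> XV Fe Xe.
have C0 : 0 <= C by rewrite mulr_ge0// pot_bound_ge0.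
have hC p p' v x : (forall x, `|p x - Num.min 0 x| <= pot_bound pt) ->
    (forall x, `|p' x - Num.min 0 x| <= pot_bound pt) -> 0 <= x ->
    `|p (v + x) - p' v| <= x + C.
  move=> pC pC' x0; rewrite /C.
  have := min0D_le _ v _ x0; have := pC (v + x); have := pC' v.
  by rewrite !ler_norml => /andP[? ?] /andP[? ?] /andP[? ?]; apply/andP; split; lra.
apply: (markov_state_step X F V q e (fun d y => d + y)
   (fun d y => pot_X pt (d + y) - pot_XY pt d)
   (fun d y => pot_XY pt (d + y) - pot_XY pt d) C XV Fe Xe C0).
- exact: measurable_funD.
- apply: measurable_funB; apply: measurableT_comp => //.
  + by apply: continuous_measurable_fun; exact: continuous_pot_X.
  + exact: measurable_funD.
  + by apply: continuous_measurable_fun; exact: continuous_pot_XY.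
- move=> v x; apply: cvgB; last exact: cvg_cst.
  apply: (@continuous_comp _ _ _ (fun y => v + y) (pot_X pt)); last exact: continuous_pot_X.
  by apply: cvgD; [exact: cvg_cst|exact: cvg_id].
- by move=> v x x0; apply: hC => //; [exact: pot_X_bounded|exact: pot_XY_bounded].
- move=> v x.
  have dp : is_derive (v + x) 1 (pot_XY pt) _ := is_derive_pot_XY pt (v + x).
  have ds : is_derive x 1 (fun y : R => v + y) 1 by apply: is_derive_eq; ring.
  have dc := @is_derive1_comp _ (pot_XY pt) (fun y : R => v + y) x _ _ dp ds.
  by apply: is_derive_eq; rewrite mulr1 subr0; ring.
- move=> v; apply: (linear_growth_sqr _ C) => // x x0.
  by apply: hC => //; exact: pot_XY_bounded.
- by move=> v; rewrite addr0 subrr.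
Qed.

Lemma markov_state_X {d} {T : measurableType d} {R : realType} {P : probability T R}
    {I : eqType} (X : I -> {RV P >-> R}) (F : pred I) (V : T -> R * R) (q : R) (e : I)
    (chi eps : R) (pt : ladder_potential R chi eps) (C := 2 * pot_bound pt) :
  markov_state X F V q -> F e -> exponential_law (distribution P (X e)) ->
  markov_state X (predD1 F e)
    (fun x => ((V x).1 - `|X e x|,
      (V x).2 + (`|X e x| + Num.min 0 ((V x).1 - `|X e x|) +
        pot_Z pt `|(V x).1 - `|X e x| | - pot_X pt (V x).1)))
    (q + (C ^+ 2 + 2 * C + 2)).
Proof.
move=> XV Fe Xe.
have C0 : 0 <= C by rewrite mulr_ge0// pot_bound_ge0.
have min0 (v x : R) : 0 <= x -> 0 <= x + Num.min 0 (v - x) - Num.min 0 v <= x.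
  by move=> x0; rewrite !minEle; do 2 case: ifPn => ?; apply/andP; split; lra.
have cmin : continuous (fun x : R => Num.min 0 x).
  by move=> x; apply: continuous_min; [exact: cvg_cst|exact: cvg_id].
have cZ : continuous (fun x : R => pot_Z pt `|x|).
  move=> x; apply: (@continuous_comp _ _ _ (fun y : R => `|y|) (pot_Z pt)).
    exact: norm_continuous.
  exact: continuous_pot_Z.
have cB (v : R) : continuous (fun x : R => v - x).
  by move=> x; apply: cvgB; [exact: cvg_cst|exact: cvg_id].
apply: (markov_state_step X F V q e (fun s x => s - x)
   (fun s x => x + Num.min 0 (s - x) + pot_Z pt `|s - x| - pot_X pt s)
   (fun s x => x + pot_X pt (s - x) - pot_X pt s) C XV Fe Xe C0).
- exact: measurable_funB.
- have mB : measurable_fun setT (fun z : R * R => z.1 - z.2) by exact: measurable_funB.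
  apply: measurable_funB; [apply: measurable_funD; [apply: measurable_funD => //|]|].
  + by apply: (measurableT_comp _ mB); exact: continuous_measurable_fun.
  + have mZ : measurable_fun setT (fun x : R => pot_Z pt `|x|).
      exact: continuous_measurable_fun.
    exact: (measurableT_comp mZ mB).
  + by apply: measurableT_comp => //; apply: continuous_measurable_fun; exact: continuous_pot_X.
- move=> v x; apply: cvgB; last exact: cvg_cst.
  apply: cvgD; first apply: cvgD; first exact: cvg_id.
    exact: (@continuous_comp _ _ _ (fun y => v - y) (fun x : R => Num.min 0 x) _ (cB v x) (cmin _)).
  exact: (@continuous_comp _ _ _ (fun y => v - y) (fun x : R => pot_Z pt `|x|) _ (cB v x) (cZ _)).
- move=> v x x0; rewrite /C.
  have := min0 v _ x0; have := pot_X_bounded pt v; have := pot_Z_bounded pt _ (normr_ge0 (v - x)).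
  by rewrite !ler_norml => /andP[? ?] /andP[? ?] /andP[? ?]; apply/andP; split; lra.
- move=> v x.
  have dp : is_derive (v - x) 1 (pot_X pt) _ := is_derive_pot_X pt (v - x).
  have ds : is_derive x 1 (fun y : R => v - y) (- 1) by apply: is_derive_eq; ring.
  have dc := @is_derive1_comp _ (pot_X pt) (fun y : R => v - y) x _ _ dp ds.
  apply: is_derive_eq; ring.
- move=> v; apply: (linear_growth_sqr _ C) => // x x0; rewrite /C.
  have := min0 v _ x0; have := pot_X_bounded pt v; have := pot_X_bounded pt (v - x).
  by rewrite !ler_norml => /andP[? ?] /andP[? ?] /andP[? ?]; apply/andP; split; lra.
- by move=> v; rewrite subr0 add0r subrr.
Qed.

(** The potential sees [min |w| Z], the absolute value of the clamped walk. *)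
Lemma markov_state_Z {d} {T : measurableType d} {R : realType} {P : probability T R}
    {I : eqType} (X : I -> {RV P >-> R}) (F : pred I) (V : T -> R * R) (q : R) (e : I)
    (chi eps : R) (pt : ladder_potential R chi eps) (C := 2 * pot_bound pt) :
  markov_state X F V q -> F e -> exponential_law (distribution P (X e)) ->
  markov_state X (predD1 F e)
    (fun x => (Num.max (- `|X e x|) (Num.min (V x).1 `|X e x|),
      (V x).2 + (pot pt (Num.min `|(V x).1| `|X e x|) - pot_Z pt `|(V x).1|)))
    (q + (C ^+ 2 + 2 * C + 2)).
Proof.
move=> XV Fe Xe.
have C0 : 0 <= C by rewrite mulr_ge0// pot_bound_ge0.
have bC : pot_bound pt <= C by rewrite /C; have := pot_bound_ge0 pt; lra.
apply: (markov_state_step X F V q e (fun w z => Num.max (- z) (Num.min w z))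
   (fun w z => pot pt (Num.min `|w| z) - pot_Z pt `|w|)
   (fun w z => cert_Z pt `|w| z) C XV Fe Xe C0).
- apply: measurable_maxr; first exact: measurableT_comp.
  exact: measurable_minr.
- apply: measurable_funB.
    have mm : measurable_fun setT (fun z : R * R => Num.min `|z.1| z.2).
      by apply: measurable_minr => //; exact: measurableT_comp.
    by apply: (measurableT_comp _ mm); apply: continuous_measurable_fun; exact: continuous_pot.
  have mm : measurable_fun setT (fun z : R * R => `|z.1|) by exact: measurableT_comp.
  by apply: (measurableT_comp _ mm); apply: continuous_measurable_fun; exact: continuous_pot_Z.
- move=> v x; apply: cvgB; last exact: cvg_cst.
  have cm : continuous (fun z : R => Num.min `|v| z).
    by move=> z; apply: (@continuous_min _ _ (fun=> `|v|) id); [exact: cvg_cst|exact: cvg_id].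
  exact: (@continuous_comp _ _ _ _ (pot pt) _ (cm x) (continuous_pot pt _)).
- move=> v x x0; rewrite /C; apply: (le_trans (ler_normB _ _)).
  have := pot_Z_bounded pt _ (normr_ge0 v).
  have m0 : 0 <= Num.min `|v| x by rewrite le_min normr_ge0 x0.
  have := pot_bounded pt _ m0; lra.
- by move=> v x; apply: is_derive_cert_Z.
- move=> v; apply: (linear_growth_sqr _ C) => // x x0.
  by apply: (le_trans (cert_Z_bounded pt _ _ (normr_ge0 v) x0)); lra.
- by move=> v; apply: cert_Z0.
Qed.

Lemma chain_state_markov {d} {T : measurableType d} {R : realType} {P : probability T R}
    (w : ledge -> {RV P >-> R}) (chi eps : R) (pt : ladder_potential R chi eps)
    (n : nat) (C := 2 * pot_bound pt) :
  mutually_independent P (fun e => (w e : T -> R)) ->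
  (forall e, exponential_law (distribution P (w e))) ->
  markov_state w (edge_after n) (fun x => chain_state pt (fun e => w e x) n)
    (n%:R * (3 * (C ^+ 2 + 2 * C + 2))).
Proof.
move=> hind hexp; elim: n => [|n IH].
  (* Mutual independence makes a constant fresh for all edges; pairing it with rung 0 starts the
     induction. *)
  have f0 : fresh w predT (cst tt : {mfun T >-> unit}).
    move=> A J B mA uJ _ mB; rewrite preimage_cst; case: ifPn => _.
      by rewrite setTI (@probability_setT _ _ _ P) mul1e; exact: hind.
    by rewrite set0I (@measure0 _ _ _ P) mul0e.
  split.
  - by apply: measurable_fun_pair => //; apply: measurableT_comp => //; exact: measurable_funP.
  - have f1 := fresh_pair w predT _ (inr 0%N) f0 isT.
    have mk : measurable_fun setT (fun z : unit * R => (`|z.2|, 0 : R)).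
      by apply: measurable_fun_pair => //; exact: measurableT_comp.
    have := fresh_comp w _ _ _ mk f1; apply: fresh_sub.
    by move=> [[b i]|[|i]].
  - by under eq_integral do rewrite /= expr0n /=; rewrite integral0 mul0r.
(* Each of the three reveals [Y], [X], [Z] adds [C ^ 2 + 2 * C + 2], hence the factor 3. *)
have := markov_state_Z w _ _ _ (inr n.+1) _ _ pt (markov_state_X w _ _ _ (inl (false, n)) _ _ pt
  (markov_state_Y w _ _ _ (inl (true, n)) _ _ pt IH _ (hexp _)) _ (hexp _)) _ (hexp _).
rewrite /= leqnn => /(_ erefl) => /(_ erefl) => /(_ (ltnSn n)) [m f q]; split => //.
- apply: fresh_sub f => -[[b i]|i] /=.
    by move=> ni; rewrite (ltnW ni) andbT; apply/andP; split => //; apply: contraTneq ni => -[_ ->]; rewrite ltnn.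
  by move=> ni; rewrite (ltnW ni) andbT; apply: contraTneq ni => -[->]; rewrite ltnn.
- apply: (le_trans q); rewrite lee_fin -natr1 -/C; lra.
Qed.

(** The increments of one column telescope to [x + min 0 s + pot (min |s| z) - pot_XY d], and
    [pot_drift] replaces [pot_XY d] by [min 0 d + pot |d| + chi] at cost [eps]. *)
Lemma chain_stateE {R : realType} (chi eps : R) (pt : ladder_potential R chi eps)
    (w : ledge -> R) (n : nat) (a := ladder_dist w n false) (b := ladder_dist w n true) :
  (forall e, 0 <= w e) ->
  (chain_state pt w n).1 = b - a /\
  `|(chain_state pt w n).2 -
     (Num.min a b + pot pt `|b - a| - pot pt (w (inr 0%N)) - n%:R * chi)| <= n%:R * eps.
Proof.
move=> w0; rewrite {}/a {}/b; elim: n => [|n [IH1 IH2]] /=.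
  have z0 := w0 (inr 0%N); rewrite !subr0 !(ger0_norm z0) (min_l z0) !mul0r.
  by split => //; rewrite normr_le0; apply/eqP; ring.
rewrite IH1 !(ger0_norm (w0 _)).
move: (w0 (inl (true, n))) (w0 (inl (false, n))) (w0 (inr n.+1)).
move: (w (inl (true, n))) (w (inl (false, n))) (w (inr n.+1)) => y x z y0 x0 z0.
move: IH2; move: (ladder_dist w n false) (ladder_dist w n true) (chain_state pt w n).2 => a b M IH2.
set s := b - a + y - x.
(* [E1] identifies the clamped walk with the new difference, [E2] computes its absolute value, and
   [E3] says that the new rung does not affect the minimum. *)
have E1 : Num.max (- z) (Num.min s z) = Num.min (b + y) (a + x + z) - Num.min (a + x) (b + y + z).
  case: (leP s z); rewrite /s => h1; case: (leP (b + y) (a + x + z)) => h2;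
  case: (leP (a + x) (b + y + z)) => h3.
  all: try by case: leP => ?; lra.
have E2 : `|Num.min (b + y) (a + x + z) - Num.min (a + x) (b + y + z)| = Num.min `|s| z.
  rewrite -E1; have [s0|s0] := leP 0 s.
    rewrite (ger0_norm s0) max_r ?ger0_norm// le_min ?s0 ?z0//; apply/andP; split; lra.
  rewrite (ltr0_norm s0) (min_l (_ : s <= z)); last by lra.
  rewrite ler0_norm; last by rewrite ge_max; apply/andP; split; lra.
  by case: (leP (- z) s) => h1; case: (leP (- s) z) => h2; lra.
have E3 : Num.min (Num.min (a + x) (b + y + z)) (Num.min (b + y) (a + x + z)) =
    a + x + Num.min 0 s.
  rewrite /s; case: (leP (b + y) (a + x + z)) => h2; case: (leP (a + x) (b + y + z)) => h3;
    case: (leP 0 (b - a + y - x)) => h1; case: leP => h4; lra.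
split => //.
rewrite E2 E3 -natr1.
have := pot_drift pt (b - a); move: IH2.
have -> : Num.min 0 (b - a) = Num.min a b - a.
  by rewrite !minEle subr_ge0; case: ifPn => ?; lra.
rewrite !ler_norml => /andP[h1 h2] /andP[h3 h4]; apply/andP; split; lra.
Qed.

(** * Limits of min(a_n, b_n) / n and of l_n / n *)

Lemma ladder_dist_ge0 {R : realType} (w : ledge -> R) (n : nat) (b : bool) :
  (forall e, 0 <= w e) -> 0 <= ladder_dist w n b.
Proof.
move=> w0; elim: n b => [|n IH] b /=; first by case: b.
by rewrite le_min !addr_ge0.
Qed.

Lemma ladder_dist_min_homo {R : realType} (w : ledge -> R) :
  (forall e, 0 <= w e) ->
  {homo (fun n => Num.min (ladder_dist w n false) (ladder_dist w n true)) :
     m n / (m <= n)%N >-> m <= n}.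
Proof.
move=> w0; apply: homo_leq => [//|x y z|n /=]; first exact: le_trans.
have := w0 (inl (false, n)); have := w0 (inl (true, n)); have := w0 (inr n.+1).
move: (w _) (w _) (w _) (ladder_dist w n false) (ladder_dist w n true) => z y x a b z0 y0 x0.
have ha : Num.min a b <= a by rewrite ge_min lexx.
have hb : Num.min a b <= b by rewrite ge_min lexx orbT.
by rewrite 3!le_min -andbA; apply/and4P; split; lra.
Qed.

Lemma ladder_dist_sub_min_le {R : realType} (w : ledge -> R) (n : nat) :
  (forall e, 0 <= w e) ->
  ladder_dist w n false <=
  Num.min (ladder_dist w n false) (ladder_dist w n true) + w (inr n).
Proof.
move=> w0; have z0 := w0 (inr n).
rewrite -lerBlDr le_min lerBlDr lerDl z0 /= lerBlDr.
case: n z0 => [|n] z0 /=; first by rewrite addr_ge0.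
move: (w _) (w _) (w _) z0 (ladder_dist w n false) (ladder_dist w n true) => z y x z0 a b.
by rewrite ge_min; case: (leP (b + z) (a + y + x)) => h; apply/orP; [right|left]; lra.
Qed.

(** [K] is fixed first, with [c K] near [l] and [e K] small; only then does [n] tend to infinity. *)
Lemma cvg_of_approx (R : realType) (u c e : nat -> R) (l : R) :
  c @ \oo --> l -> e @ \oo --> 0 ->
  (forall K delta, 0 < delta -> \forall n \near \oo, `|u n - c K| <= e K + delta) ->
  u @ \oo --> l.
Proof.
move=> /cvgrPdist_lt cl /cvgrPdist_lt e0 h; apply/cvgrPdist_lt => d d0.
have d4 : 0 < d / 4 by rewrite divr_gt0.
have [K [cK eK]] : exists K, `|l - c K| < d / 4 /\ `|0 - e K| < d / 4.
  near \oo => K; exists K; split; near: K; [exact: cl|exact: e0].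
move: (h K _ d4); apply: filterS => n.
have -> : l - u n = (l - c K) - (u n - c K) by ring.
move=> un; apply: (le_lt_trans (ler_normB _ _)).
by move: eK; rewrite sub0r normrN => /ltr_normlP[_ eK]; lra.
Unshelve. all: by end_near. Qed.

(** At time [N = (n+1)^2] the martingale has second moment at most [C3 * N]; divided by [N], it has
    second moment at most [C3 / (n+1)^2], which is summable. *)
Lemma ae_ladder_approx {d} {T : measurableType d} {R : realType} {P : probability T R}
    (w : ledge -> {RV P >-> R}) (chi eps : R) (pt : ladder_potential R chi eps) :
  mutually_independent P (fun e => (w e : T -> R)) ->
  (forall e, exponential_law (distribution P (w e))) ->
  {ae P, forall x, (forall e, 0 <= w e x) -> forall delta, 0 < delta ->
    \forall n \near \oo,
    `|Num.min (ladder_dist (fun e => w e x) (n.+1 ^ 2) false)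
              (ladder_dist (fun e => w e x) (n.+1 ^ 2) true) / (n.+1 ^ 2)%:R - chi|
      <= eps + delta}.
Proof.
move=> hind hexp.
pose C := 2 * pot_bound pt; pose C3 := 3 * (C ^+ 2 + 2 * C + 2).
pose f n x := (chain_state pt (fun e => w e x) (n.+1 ^ 2)).2 / (n.+1 ^ 2)%:R.
have mc n : measurable_fun setT (fun x => (chain_state pt (fun e => w e x) n).2).
  have [m _ _] := chain_state_markov w _ _ pt n hind hexp.
  exact: (measurableT_comp measurable_snd m).
have mf n : measurable_fun setT (f n) by apply: measurable_funM.
have fC n : (\int[P]_x ((f n x) ^+ 2)%:E <= (C3 / n.+1%:R ^+ 2)%:E)%E.
  have [_ _] := chain_state_markov w _ _ pt (n.+1 ^ 2) hind hexp; rewrite -/C -/C3 => q.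
  set N := (n.+1 ^ 2)%N in q *; rewrite -natrX -/N.
  have N0 : 0 < N%:R :> R by rewrite ltr0n /N expn_gt0.
  under eq_integral do rewrite /f -/N exprMn mulrC EFinM.
  rewrite ge0_integralZl//; last 2 first.
  - by apply/measurable_EFinP; exact: measurable_funX.
  - by move=> x _; rewrite lee_fin sqr_ge0.
  have -> : (C3 / N%:R)%:E = ((N%:R^-1 ^+ 2)%:E * (N%:R * C3)%:E)%E.
    by rewrite -EFinM; congr EFin; field; rewrite gt_eqF.
  by rewrite lee_wpmul2l// lee_fin sqr_ge0.
have := ae_cvg0_sqr _ _ _ mf fC; apply: filterS => x fx w0 delta delta0.
have d2 : 0 < delta / 2 by rewrite divr_gt0.
have fd : \forall n \near \oo, `|f n x| <= delta / 2.
  have /cvgrPdist_lt/(_ _ d2) := fx.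
  by apply: filterS => n; rewrite sub0r normrN => /ltW.
near=> n.
have fn : `|f n x| <= delta / 2 by near: n.
(* The potentials at times 0 and [N] contribute at most [C] together, eventually below
   [delta / 2 * N]. *)
have nC : C <= delta / 2 * n.+1%:R.
  rewrite mulrC -ler_pdivrMr//; apply: (@le_trans _ _ n%:R); last by rewrite ler_nat.
  by near: n; exact: nbhs_infty_ger.
have := chain_stateE _ _ pt (fun e => w e x) (n.+1 ^ 2) w0 => -[_].
move: fn; rewrite /f; set N := (n.+1 ^ 2)%N; set M := (chain_state _ _ _).2.
have nN : n.+1%:R <= N%:R :> R by rewrite ler_nat /N expnS leq_pmulr.
have N0 : 0 < N%:R :> R by rewrite ltr0n /N expn_gt0.
set a := ladder_dist _ _ _; set b := ladder_dist _ _ _.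
have := pot_bounded pt _ (normr_ge0 (b - a)); have := pot_bounded pt _ (w0 (inr 0%N)).
rewrite normrM normfV (gtr0_norm N0) ler_pdivrMr// => p1 p2 p3 p4.
have -> : Num.min a b / N%:R - chi = (Num.min a b - N%:R * chi) / N%:R.
  by field; rewrite gt_eqF.
rewrite normrM normfV (gtr0_norm N0) ler_pdivrMr//.
have nCN : C <= delta / 2 * N%:R by apply: (le_trans nC); rewrite ler_wpM2l// ltW.
move: nCN p1 p2 p3 p4; rewrite /C !ler_norml.
move=> nCN /andP[? ?] /andP[? ?] /andP[? ?] /andP[? ?]; apply/andP; split; lra.
Unshelve. all: by end_near. Qed.

Lemma ae_exponential_law_ge0 {d} {T : measurableType d} {R : realType}
    {P : probability T R} (X : {RV P >-> R}) :
  exponential_law (distribution P X) -> {ae P, forall x, 0 <= X x}.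
Proof.
move=> Xe; exists (X @^-1` [set x | x < 0]); split.
- by rewrite -[Y in measurable Y]setTI; apply: measurable_funP => //; exact: measurable_itv `]-oo, 0[.
- have -> : P (X @^-1` [set x | x < 0]) = distribution P X `]-oo, 0[%classic by rewrite set_itvE.
  rewrite Xe//; apply: integral0_eq => x; rewrite /= in_itv/= => x0.
  by rewrite lt0_exponential_pdf.
- by move=> x /= /negP; rewrite -ltNge.
Qed.

Lemma ae_exponential_law_div {d} {T : measurableType d} {R : realType}
    {P : probability T R} (X : nat -> {RV P >-> R}) :
  (forall n, exponential_law (distribution P (X n))) ->
  {ae P, forall x, (fun n => X n x / n%:R) @ \oo --> (0 : R)}.
Proof.
move=> Xe.
pose f n x := `|X n.+1 x| / n.+1%:R.
have mX n : measurable_fun setT (fun x => `|X n x|).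
  by apply: measurableT_comp => //; exact: measurable_funP.
have mf n : measurable_fun setT (f n) by apply: measurable_funM.
have X2 n : (\int[P]_x (`|X n x| ^+ 2)%:E <= 6%:E)%E.
  (* [|y|] is split into its mean 1 and the centred part [|y| - 1], certified by the identity; the
     general bound with [m = C = 1] is 6. *)
  have -> : (\int[P]_x (`|X n x| ^+ 2)%:E =
      \int[distribution P (X n)]_y ((1 + (`|y| - 1)) ^+ 2)%:E)%E.
    rewrite ge0_integral_distribution//.
    - by apply: eq_integral => x _ /=; congr ((_ ^+ 2)%:E); ring.
    - apply/measurable_EFinP; apply: measurable_funX; apply: measurable_funD => //.
      by apply: measurable_funB => //; exact: measurableT_comp.
  have -> : 6 = 1 ^+ 2 + (1 ^+ 2 + 2 * 1 + 2) :> R by ring.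
  apply: (exponential_law_sqr_le _ _ (fun y => y - 1) id 1 1 1 (Xe n)) => //.
  - by move=> x; apply: cvgB; [exact: cvg_id|exact: cvg_cst].
  - by move=> x x0; rewrite (le_trans (ler_normB _ _))// normr1 ger0_norm.
  - by move=> x; apply: is_derive_eq; ring.
  - by move=> x x0; rewrite ger0_norm//; nra.
have fC n : (\int[P]_x ((f n x) ^+ 2)%:E <= (6 / n.+1%:R ^+ 2)%:E)%E.
  under eq_integral do rewrite /f exprMn mulrC EFinM.
  rewrite ge0_integralZl//; last first.
    by apply/measurable_EFinP; exact: measurable_funX.
  have -> : (6 / n.+1%:R ^+ 2)%:E = ((n.+1%:R^-1 ^+ 2)%:E * 6%:E)%E :> \bar R.
    by rewrite -EFinM (mulrC 6) exprVn.
  by rewrite lee_wpmul2l// lee_fin sqr_ge0.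
have := ae_cvg0_sqr _ _ _ mf fC; apply: filterS => x fx.
rewrite -(cvg_shiftS (fun n => X n x / n%:R)); apply/norm_cvg0P.
apply: cvg_trans fx; apply: near_eq_cvg; apply: nearW => n /=.
by rewrite /f normrM normfV (ger0_norm (ler0n R _)).
Qed.

Theorem mainTheorem11 (R : realType) (d : measure_display) (T : measurableType d)
    (P : probability T R) (w : ledge -> {RV P >-> R})
    (hind : mutually_independent P (fun e => (w e : T -> R)))
    (hexp : forall (e : ledge) (B : set R), measurable B ->
              distribution P (w e) B = exponential_prob 1 B) :
  {ae P, forall omega : T,
     (fun n : nat => ladder_passage (fun e => w e omega) n / n%:R) @ \oo
       --> (3 / 2 - besselJ 1 2 / (2 * besselJ 2 2) : R)}.
Proof.
have [chi_cvg eps_cvg] := ladder_constant_cvg R.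
have pos : {ae P, forall x, forall e, 0 <= w e x}.
  (* Edges are countable, so [pickle] turns the condition on all of them into a countable
     intersection. *)
  have : {ae P, forall x (n : nat),
      if unpickle n is Some e then 0 <= w (e : bool * nat + nat)%type x else true}.
    apply: ae_foralln => n; case: unpickle => [e|]; last exact: aeW.
    by apply: ae_exponential_law_ge0 => B; exact: hexp.
  by apply: filterS => x xn e; have := xn (pickle (e : bool * nat + nat)%type); rewrite pickleK.
have rung : {ae P, forall x, (fun n => w (inr n) x / n%:R) @ \oo --> (0 : R)}.
  by apply: ae_exponential_law_div => n B; exact: hexp.
have approx : {ae P, forall x (K : nat), (forall e, 0 <= w e x) -> forall delta, 0 < delta ->
    \forall n \near \oo,
    `|Num.min (ladder_dist (fun e => w e x) (n.+1 ^ 2) false)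
              (ladder_dist (fun e => w e x) (n.+1 ^ 2) true) / (n.+1 ^ 2)%:R -
      (3 / 2 - (\sum_(k < K.+2) bessel_coef 1 k) / (2 * \sum_(k < K.+1) bessel_coef 2 k))|
      <= `|bessel_coef 2 K| / (2 * \sum_(k < K.+1) bessel_coef 2 k) + delta}.
  apply: ae_foralln => K.
  have A0 : 0 < \sum_(k < K.+1) bessel_coef 2 k :> R.
    by apply: lt_le_trans (sum_bessel_coef2_ge R K); rewrite addr_gt0// mulr_gt0// exprn_gt0.
  have [pt] := exists_ladder_potential R K A0.
  by apply: (ae_ladder_approx _ _ _ pt hind) => e B; exact: hexp.
move: pos rung approx; apply: filterS3 => x w0 Zn un.
set v : ledge -> R := fun e => w e x.
pose mu n := Num.min (ladder_dist v n false) (ladder_dist v n true).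
have mu_cvg : (fun n => mu n / n%:R) @ \oo --> (3 / 2 - besselJ 1 2 / (2 * besselJ 2 2) : R).
  apply: cvg_div_of_squares.
  - by move=> n; rewrite le_min !ladder_dist_ge0.
  - exact: ladder_dist_min_homo.
  - apply: (cvg_of_approx _ _ _ _ _ chi_cvg eps_cvg) => K delta delta0.
    exact: un.
(* [mu n <= l_n <= mu n + Z_n], where [Z_n] is the weight of rung [n] and [Z_n / n] tends to 0. *)
apply: (@squeeze_cvgr _ _ _ _ (fun n => mu n / n%:R) (fun n => mu n / n%:R + v (inr n) / n%:R)) => //.
  apply: nearW => n; rewrite ladder_passageE -mulrDl.
  have n0 : (0 : R) <= n%:R^-1 by rewrite invr_ge0.
  rewrite !ler_wpM2r//; first exact: ladder_dist_sub_min_le.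
  by rewrite ge_min lexx.
by rewrite -[X in _ --> X]addr0; exact: cvgD.
Qed.
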